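(* Let $\beta,\sigma,\rho>0$ and consider the Lorenz system with a single input and control vector $f$, $$\dot x=\begin{bmatrix}-\sigma&\sigma&0\\ \rho&-1&0\\ 0&0&-\beta\end{bmatrix}x+\begin{bmatrix}0\\ -x_1x_3\\ x_1x_2\end{bmatrix}+uf\quad\text{in }\mathbb{R}^3 .$$ Define the constants $\mathfrak{s}=\beta^2-(\sigma+1)\beta+\sigma(1-\rho)$ and $\mathfrak{d}$ by $\mathfrak{d}^2=4\rho\sigma+(\sigma-1)^2$. Define the vectors $v_{\pm}=\left(1,\frac{\sigma-1\pm\mathfrak{d}}{2\sigma},0\right)^T$ and $w_{\pm}=\left(\frac{1-\sigma\pm\mathfrak{d}}{2\rho},1,0\right)^T$, and the subspaces $V_{3+}=\mathrm{Span}\{\mathbf{e}_3,v_+\}$, $V_{3-}=\mathrm{Span}\{\mathbf{e}_3,v_-\}$, $W_{3+}=\mathrm{Span}\{\mathbf{e}_3,w_+\}$, $W_{3-}=\mathrm{Span}\{\mathbf{e}_3,w_-\}$. Assume $\mathfrak{s}\ne0$. Then the system is small-time locally controllable from the origin if and only if $f\notin V_{3+}\cup V_{3-}\cup W_{3+}\cup W_{3-}\cup\mathrm{Span}\{\mathbf{e}_3\}^{\perp}$.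
   Context: $\mathbf{e}_1,\mathbf{e}_2,\mathbf{e}_3$ is the canonical basis of $\mathbb{R}^3$ and $\perp$ is the Euclidean orthogonal complement. The control vector field $f\in\mathbb{R}^3$ is constant and nonzero. The scalar control $u$ takes values in a bounded set $U\subset\mathbb{R}$ whose affine hull is $\mathbb{R}$. Admissible controls are Lebesgue integrable functions $u(\cdot):[0,T]\to U$, $T>0$; an admissible trajectory is an absolutely continuous curve satisfying the equation for almost all $t\in[0,T]$. $\mathcal{R}(T,p)$ is the set of $q$ for which there is an admissible trajectory with $x(0)=p$, $x(T)=q$, and $\mathcal{R}(\le T,p)=\bigcup_{0\le t\le T}\mathcal{R}(t,p)$. The system is small-time locally controllable from $p$ if $p$ is in the interior of $\mathcal{R}(\le T,p)$ for all $T>0$.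
   Formalization: The ''if'' part additionally assumes that 0 is interior to the convex hull of U; without this (e.g. U={1,2}) the system is never small-time locally controllable from the origin, so the claim fails. The ''only if'' part is proved for every bounded U with affine hull R. *)

(* Defs.v *)
From HB Require Import structures.
From mathcomp Require Import all_boot all_order all_algebra.
From mathcomp Require Import all_classical all_reals all_analysis.
Import Order.TTheory GRing.Theory Num.Theory.
Import numFieldNormedType.Exports.

Set Implicit Arguments.
Unset Strict Implicit.
Unset Printing Implicit Defensive.

Local Open Scope classical_set_scope.
Local Open Scope ring_scope.

Section Hulls.
Variable R : realType.

Definition affine_hull (U : set R) : set R :=
  [set y | exists (n : nat) (a v : 'I_n -> R),
     [/\ forall i, U (v i), \sum_i a i = 1 & y = \sum_i a i * v i]].

Definition convex_hull (U : set R) : set R :=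
  [set y | exists (n : nat) (a v : 'I_n -> R),
     [/\ forall i, U (v i), forall i, 0 <= a i,
         \sum_i a i = 1 & y = \sum_i a i * v i]].

End Hulls.

Section OrthogonalComplement.
Variables (R : realType) (n : nat).

Definition dotv (x y : 'cV[R]_n) : R := \sum_i x i 0 * y i 0.

Definition orthocomp (W : {vspace 'cV[R]_n}) : set 'cV[R]_n :=
  [set x | forall y, y \in W -> dotv x y = 0].

End OrthogonalComplement.

Section ControlSystems.
Variables (R : realType) (n : nat).
Local Notation V := 'cV[R]_n.+1.

(* The norm on column vectors is the sup norm; since all norms on R^n are
   equivalent, neither this notion nor the topology depends on that choice. *)
Definition abs_continuous (a b : R) (x : R -> V) : Prop :=
  forall e : R, 0 < e -> exists2 d : R, 0 < d &
    forall (k : nat) (l r : 'I_k -> R),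
      (forall i, a <= l i /\ l i <= r i /\ r i <= b) ->
      trivIset setT (fun i => `]l i, r i[%classic) ->
      \sum_i (r i - l i) < d ->
      \sum_i `|x (r i) - x (l i)| < e.

(* [lebesgue_measure] lives on the Borel sets; taking Lebesgue-measurable
   controls instead gives the same trajectories, as such a control agrees almost
   everywhere with a Borel one that has values in the same set [U]. *)
Definition admissible_control (U : set R) (T : R) (u : R -> R) : Prop :=
  (forall t, t \in `[0, T] -> U (u t)) /\
  (@lebesgue_measure R).-integrable `[0, T] (EFin \o u).

(* Trajectories of x' = F x + u f on [0, T]. The functions are total, but only
   their values on [0, T] matter. *)
Definition admissible_trajectory (F : V -> V) (f : V) (U : set R)
    (T : R) (x : R -> V) : Prop :=
  abs_continuous 0 T x /\
  exists2 u : R -> R, admissible_control U T u &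
    {ae (@lebesgue_measure R), forall t : R, t \in `[0, T] ->
       is_derive t (1 : R) x (F (x t) + u t *: f)}.

Definition reachable (F : V -> V) (f : V) (U : set R) (T : R) (p : V) : set V :=
  [set q | exists x : R -> V,
     [/\ admissible_trajectory F f U T x, x 0 = p & x T = q]].

Definition reachable_le (F : V -> V) (f : V) (U : set R) (T : R) (p : V) :
    set V :=
  [set q | exists2 t : R, 0 <= t <= T & reachable F f U t p q].

Definition STLC (F : V -> V) (f : V) (U : set R) (p : V) : Prop :=
  forall T : R, 0 < T -> interior (reachable_le F f U T p) p.

End ControlSystems.

Section Lorenz.
Variable R : realType.
Implicit Types beta sigma rho d : R.

(* The coordinates x_1, x_2, x_3 are the entries with indices 0, 1, 2. *)
Definition vec3 (a b c : R) : 'cV[R]_3 := \col_i [:: a; b; c]`_i.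

Definition e3 : 'cV[R]_3 := vec3 0 0 1.

Definition lorenz_matrix beta sigma rho : 'M[R]_3 :=
  \matrix_(i, j) (nth [::] [:: [:: - sigma; sigma; 0];
                              [:: rho; - 1; 0];
                              [:: 0; 0; - beta]] i)`_j.

Definition lorenz_drift beta sigma rho (x : 'cV[R]_3) : 'cV[R]_3 :=
  lorenz_matrix beta sigma rho *m x +
  vec3 0 (- (x 0 0 * x 2 0)) (x 0 0 * x 1 0).

Definition lorenz_s beta sigma rho : R :=
  beta ^+ 2 - (sigma + 1) * beta + sigma * (1 - rho).

(* With [d] a square root of 4 rho sigma + (sigma - 1)^2, the vectors v_+, w_+
   are [lorenz_v sigma d], [lorenz_w sigma rho d], and v_-, w_- are obtained
   by replacing [d] with [- d]. *)
Definition lorenz_v sigma d : 'cV[R]_3 :=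
  vec3 1 ((sigma - 1 + d) / (2 * sigma)) 0.

Definition lorenz_w sigma rho d : 'cV[R]_3 :=
  vec3 ((1 - sigma + d) / (2 * rho)) 1 0.

Definition lorenz_exceptional sigma rho d : set 'cV[R]_3 :=
  [set` <<[:: e3; lorenz_v sigma d]>>%VS] `|`
  [set` <<[:: e3; lorenz_v sigma (- d)]>>%VS] `|`
  [set` <<[:: e3; lorenz_w sigma rho d]>>%VS] `|`
  [set` <<[:: e3; lorenz_w sigma rho (- d)]>>%VS] `|`
  orthocomp <[e3]>%VS.

End Lorenz.

(* Main.v *)
From HB Require Import structures.
Require Import Defs.
From mathcomp Require Import all_boot all_order all_algebra.
From mathcomp Require Import all_classical all_reals all_analysis.
From mathcomp Require Import measurable_realfun ring lra.
Import Order.TTheory GRing.Theory Num.Theory.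
Import numFieldNormedType.Exports.
Set Implicit Arguments.
Unset Strict Implicit.
Unset Printing Implicit Defensive.
Local Open Scope classical_set_scope.
Local Open Scope ring_scope.

(** The origin is an equilibrium of the drift, and the linear part there splits
into the block A12 acting on the first two coordinates and the scalar - beta.
The vectors v_+ and w_+, v_- and w_- are proportional to the two eigenvectors
of A12, so the exceptional set is f_3 = 0 or Q(f) = 0, where
Q(f) = rho f_1^2 + (sigma - 1) f_1 f_2 - sigma f_2^2 vanishes exactly when
(f_1, f_2) is an eigenvector of A12 or zero ([lorenz_exceptionalE]). Up to
sign, f_3 s Q(f) is the determinant of (A^2 f, A f, f); since s is nonzero, f is
exceptional exactly when the linearisation is not controllable.

Exceptional f: some function y of time and state, whose derivative does not
involve the control, vanishes at the origin and satisfies y' >= - C |y| along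
every short trajectory. It therefore stays nonnegative ([ac_barrier]), although it is
negative at points arbitrarily close to the origin. When two components f_a, f_b
of f are nonzero and the missing direction q obeys q' = c q +- x_a x_b, the
integral of the control enters x_a x_b through the square of definite sign
f_a f_b v^2; the correction K t w^2, with w = f_b x_a - f_a x_b, absorbs all other
quadratic terms, its derivative K w^2 being as large as needed
([quadratic_obstruction]). This settles f_3 = 0 with f_1 f_2 nonzero, with
q = x_3, and Q(f) = 0 with f_1 f_3 nonzero, with q the left eigenvector of A12
killing (f_1, f_2). If f_1 = f_3 = 0 then y is x_3 - x_1^2 / (2 sigma) up to sign;
if f_2 = f_3 = 0 it is 2 rho x_3 - x_3^2 - x_2^2 up to sign; if f_1 = f_2 = 0
then the x_3 axis is invariant. Trajectories being only absolutely
continuous, differential inequalities valid almost everywhere are integrated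
by [ac_mean_value].

Other f: the convex hull of U being a neighbourhood of 0, the set U contains
a < 0 < b, and controls with values a and b suffice ([bang_bang_STLC]). A
controllable linear system is steered to p in time T along an explicit curve
X(t, p) linear in p, driven by a control with primitive W(t, p). Replace W by a
sawtooth V with slopes a and b that agrees with W on a grid of mesh h: the
difference V - W is O(h), and so is its Lipschitz constant in p. In the
equation for eta = x - X - (V - W) f the control no longer appears, so eta is
the fixed point of an integral operator; asking in addition p = q - eta(T) makes
the endpoint x(T) equal to q. This operator is a contraction as soon as T, then
the size of p, then h are small ([forced_fixed_point]): the nonlinear flow and
the inversion of the endpoint map are obtained in one stroke. *)

(** * Absolutely continuous functions *)

(** The derivative as an explicit first-order expansion, the form in which
it is fed to [gauge_induction] and in which derivatives are established. *)
Lemma is_deriveE (R : realType) (W : normedModType R) (y : R -> W) (t : R) (D : W) :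
  is_derive t (1 : R) y D <->
  (forall e : R, 0 < e -> exists2 dl : R, 0 < dl &
     forall s, `|s - t| < dl -> `|y s - y t - (s - t) *: D| <= e * `|s - t|).
Proof.
pose q := fun h : R => h^-1 *: (y (h *: (1 : R) + t) - y t).
have key : q h @[h --> 0^'] --> D <->
  (forall e : R, 0 < e -> exists2 dl : R, 0 < dl &
     forall s, `|s - t| < dl -> `|y s - y t - (s - t) *: D| <= e * `|s - t|).
  split.
    move=> /cvgrPdist_le qD e e0.
    have [dl /= dl0 H] := qD e e0.
    exists dl => // s std.
    have [->|nst] := eqVneq s t; first by rewrite !subrr scale0r subr0 !normr0 mulr0.
    have nz : s - t != 0 by rewrite subr_eq0.
    have := H (s - t); rewrite /= sub0r normrN => /(_ std nz).
    rewrite /q scaler1 subrK => H1.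
    rewrite -[y s - y t](scalerKV nz) -scalerBr normrZ mulrC.
    by rewrite ler_wpM2r// distrC.
  move=> H; apply/cvgrPdist_le => e e0.
  have [dl dl0 Hd] := H e e0.
  exists dl => // h /=; rewrite sub0r normrN => hd h0.
  have := Hd (h + t); rewrite addrK => /(_ hd) H1.
  rewrite /q scaler1 distrC -[D](scalerK h0) -scalerBr normrZ normfV.
  by rewrite mulrC ler_pdivrMr ?normr_gt0.
split=> [[dy dE]|/key qD].
  by apply/key; rewrite -dE; exact: dy.
split; first by apply/cvg_ex; exists D.
by rewrite /derive; apply/cvg_lim.
Qed.

(** Cousin's lemma in inductive form: the compact interval has a partition
subordinate to the gauge [dl], and [P] is additive along partitions. The local
hypothesis only concerns intervals containing the tag [t]. *)
Lemma gauge_induction (R : realType) (P : R -> R -> Prop) (a b : R) : a <= b ->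
  (forall l m r, a <= l -> l <= m -> m <= r -> r <= b -> P l m -> P m r -> P l r) ->
  (forall t, a <= t <= b -> exists2 dl : R, 0 < dl &
     forall l r, a <= l -> l <= t -> t <= r -> r <= b -> t - dl < l -> r < t + dl -> P l r) ->
  P a b.
Proof.
move=> ab Pcat Ploc.
pose S := [set t | a <= t <= b /\ P a t].
have Paa : P a a.
  have [|dl dl0 H] := Ploc a; first by rewrite lexx.
  by apply: H => //; lra.
have Sa : S a by split=> //; rewrite lexx.
have supS : has_sup S.
  by split; [exists a|exists b => t [] /andP[]].
have ac : a <= sup S by apply: ub_le_sup => //; case: supS.
have cb : sup S <= b by apply: ge_sup; [exists a|move=> t [] /andP[]].
have [|dl dl0 H] := Ploc (sup S); first by rewrite ac.
have [t [/andP[at_ tb] Pat] tc] := sup_adherent dl0 supS.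
have tS : t <= sup S.
  apply: ub_le_sup; [by case: supS|by split; rewrite ?at_].
pose c' := Num.min b (sup S + dl / 2).
have cc' : sup S <= c' by rewrite /c' le_min cb /=; lra.
have c'b : c' <= b by rewrite /c' ge_min lexx.
have c'd : c' < sup S + dl by rewrite /c' gt_min; apply/orP; right; lra.
have Pac : P a c'.
  apply: (Pcat a t c') => //; first exact: le_trans cc'.
  exact: H.
have : c' <= sup S.
  apply: ub_le_sup; [by case: supS|split => //].
  by rewrite (le_trans ac cc').
rewrite /c' ge_min => /orP[bS|]; last by lra.
suff <- : c' = b by [].
apply/eqP; rewrite eq_le c'b /=; exact: le_trans cc'.
Qed.

(** [abs_continuous] for scalar functions, on an interval starting at 0. *)
Definition ac_on (R : realType) (T : R) (y : R -> R) : Prop :=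
  forall e : R, 0 < e -> exists2 d : R, 0 < d &
    forall (k : nat) (l r : 'I_k -> R),
      (forall i, 0 <= l i /\ l i <= r i /\ r i <= T) ->
      trivIset setT (fun i => `]l i, r i[%classic) ->
      \sum_i (r i - l i) < d ->
      \sum_i `|y (r i) - y (l i)| < e.

Lemma ac_on_seq (R : realType) (T : R) (y : R -> R) : ac_on T y ->
  forall e : R, 0 < e -> exists2 d : R, 0 < d &
  forall s : seq (R * R),
    all (fun p => [&& 0 <= p.1, p.1 <= p.2 & p.2 <= T]) s ->
    pairwise (fun p q : R * R => p.2 <= q.1) s ->
    \sum_(p <- s) (p.2 - p.1) < d ->
    \sum_(p <- s) `|y p.2 - y p.1| < e.
Proof.
move=> acy e /acy[d d0 H]; exists d => // s sT sdis.
rewrite !(big_nth (0, 0)) !big_mkord => slen.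
apply: (H (size s) (fun i => (nth (0, 0) s i).1) (fun i => (nth (0, 0) s i).2)) => //.
  by move=> i; have /and3P[] := (all_nthP (0, 0) sT) _ (ltn_ord i).
have key (i j : 'I_(size s)) : (i < j)%N ->
    ~ (`](nth (0, 0) s i).1, (nth (0, 0) s i).2[%classic `&`
       `](nth (0, 0) s j).1, (nth (0, 0) s j).2[%classic !=set0).
  move=> ij [x [/=]]; rewrite !in_itv /= => /andP[_ x1] /andP[x2 _].
  have := (pairwiseP (0, 0) sdis) i j (ltn_ord i) (ltn_ord j) ij.
  by rewrite leNgt (lt_trans x2).
move=> i j _ _ ne; apply/val_inj/eqP; case: (ltngtP i j) => // ij; exfalso.
  exact: key ij ne.
by apply: (key _ _ ij); rewrite setIC.
Qed.

(** At a tag where the derivative exists, the increment over a short interval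
is at least [(c - e) (r - l)]. The other tags lie in a null set, which has an
open neighbourhood [O] of small measure; the intervals inside [O] are collected
in the list [s], and by absolute continuity they contribute little in total. *)
Lemma ac_mean_value (R : realType) (T : R) (y : R -> R) (c a b : R) :
  ac_on T y -> 0 <= a -> a <= b -> b <= T ->
  {ae (@lebesgue_measure R), forall t, t \in `[a, b] ->
      exists2 D, c <= D & is_derive t (1 : R) y D} ->
  c * (b - a) <= y b - y a.
Proof.
move=> acy a0 ab bT [N [mN N0 subN]].
suff key e : 0 < e -> c * (b - a) <= y b - y a + e * (b - a + 1 + `|c|).
  apply/ler_addgt0Pr => e e0.
  have p0 : 0 < b - a + 1 + `|c| by have := normr_ge0 c; lra.
  have := key (e / (b - a + 1 + `|c|)) (divr_gt0 e0 p0).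
  by rewrite divfK// gt_eqF.
move=> e0.
have [d' d0' Hd'] := ac_on_seq acy e0.
(* Bounding the total length by [e] as well pays for the slope [c] that is not
   achieved on the intervals of [s]. *)
pose d := Num.min d' e; have d0 : 0 < d by rewrite lt_min d0'.
have [|||O [oO NO mO]] := lebesgue_regularity_outer (D := N) (eps := d) => //.
  have N0' : @lebesgue_measure R N = 0%E := N0.
  by rewrite [X in (X < _)%E](_ : _ = 0%E) ?ltry//.
have mO' : measurable O by exact: open_measurable.
have muO : (lebesgue_measure O < d%:E)%E.
  rewrite (@measureDI _ _ _ lebesgue_measure O N) //.
  rewrite [X in (_ + X)%E](_ : _ = 0%E) ?adde0//.
  by apply: (subset_measure0 (B := N)) => //; exact: measurableI.
pose P l r := exists s : seq (R * R),
  [/\ all (fun p => [&& l <= p.1, p.1 <= p.2 & p.2 <= r]) s,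
      pairwise (fun p q : R * R => p.2 <= q.1) s,
      ((\sum_(p <- s) (p.2 - p.1))%:E <= lebesgue_measure (O `&` `]l, r]%classic))%E &
      (c - e) * (r - l) - \sum_(p <- s) `|y p.2 - y p.1|
        - `|c| * (\sum_(p <- s) (p.2 - p.1)) <= y r - y l].
suff [s [s1 s2 s3 s4]] : P a b.
  have : \sum_(p <- s) (p.2 - p.1) < d.
    rewrite -lte_fin; apply: le_lt_trans s3 _; apply: le_lt_trans muO.
    by apply: le_measure; rewrite ?inE//; apply: measurableI.
  rewrite lt_min => /andP[sd' se].
  have : \sum_(p <- s) `|y p.2 - y p.1| < e.
    apply: Hd' => //.
      apply: sub_all s1 => p /and3P[p1 p2 p3]; apply/and3P; split=> //.
        exact: le_trans p1.
      exact: le_trans bT.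
  have : `|c| * (\sum_(p <- s) (p.2 - p.1)) <= `|c| * e.
    by rewrite ler_wpM2l// ltW.
  lra.
apply: gauge_induction => //.
  move=> l m r al lm mr rb [s [s1 s2 s3 s4]] [t [t1 t2 t3 t4]].
  exists (s ++ t); split.
  - rewrite all_cat; apply/andP; split.
      by apply: sub_all s1 => p /and3P[p1 p2 p3]; rewrite p1 p2 (le_trans p3).
    by apply: sub_all t1 => p /and3P[p1 p2 p3]; rewrite (le_trans lm p1) p2.
  - rewrite pairwise_cat s2 t2 !andbT; apply/allrelP => p q ps qt.
    have /and3P[_ _ p3] := allP s1 _ ps.
    have /and3P[q1 _ _] := allP t1 _ qt.
    exact: le_trans q1.
  - rewrite big_cat /= EFinD.
    have -> : O `&` `]l, r]%classic =
        (O `&` `]l, m]%classic) `|` (O `&` `]m, r]%classic).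
      by rewrite -setIUr -itv_bndbnd_setU// bnd_simp.
    rewrite measureU; last 3 first.
      exact: measurableI.
      exact: measurableI.
    + apply/seteqP; split=> x //= [[_ +] [_ +]].
      by rewrite !in_itv /= => /andP[_ xm] /andP[mx _]; lra.
    exact: leeD.
  - rewrite !big_cat /=; lra.
move=> t tab.
have [Nt|Nt] := pselect (N t).
  have : nbhs t O by apply: open_nbhs_nbhs; split=> //; exact: NO.
  move=> /nbhs_ballP[dl /= dl0 Hdl].
  exists dl => // l r al lt_ tr rb dll dlr.
  have lrO x : l <= x -> x <= r -> O x.
    by move=> lx xr; apply: Hdl; rewrite /ball /= ltr_norml; lra.
  exists [:: (l, r)]; rewrite !big_seq1 /= !lexx (le_trans lt_ tr) /=; split => //.
    rewrite (_ : _ `&` _ = `]l, r]%classic).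
      rewrite lebesgue_measure_itv /= lte_fin; case: ltP => //.
      by move=> rl; rewrite lee_fin; lra.
    apply/setIidr => x /=; rewrite in_itv /= => /andP[lx xr].
    by apply: lrO => //; exact: ltW.
  have : y l - y r <= `|y r - y l| by rewrite distrC ler_norm.
  have : 0 <= (r - l) * e by rewrite mulr_ge0//; lra.
  have : c * (r - l) <= `|c| * (r - l).
    by rewrite ler_wpM2r ?ler_norm// subr_ge0 (le_trans lt_).
  lra.
have [D cD dy] : exists2 D, c <= D & is_derive t (1 : R) y D.
  apply: contrapT => nD; apply: Nt; apply: subN => /=.
  by move=> H; apply: nD; apply: H; rewrite in_itv.
have [dl dl0 Hdl] := (is_deriveE y t D).1 dy e e0.
exists dl => // l r al lt_ tr rb dll dlr.
exists [::]; rewrite !big_nil; split => //.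
have h1 : `|y l - y t - (l - t) *: D| <= e * `|l - t|.
  by apply: Hdl; rewrite ler0_norm; lra.
have h2 : `|y r - y t - (r - t) *: D| <= e * `|r - t|.
  by apply: Hdl; rewrite ger0_norm; lra.
move: h1 h2; rewrite (ler0_norm (x := l - t)) ?subr_le0//.
rewrite (ger0_norm (x := r - t)) ?subr_ge0// !ler_norml /GRing.scale /=.
move=> /andP[_ h1] /andP[h2 _].
have : c * (r - l) <= D * (r - l) by rewrite ler_wpM2r//; lra.
lra.
Qed.

Lemma ae_imply (R : realType) (P Q : R -> Prop) : (forall t, P t -> Q t) ->
  {ae (@lebesgue_measure R), forall t, P t} ->
  {ae (@lebesgue_measure R), forall t, Q t}.
Proof.
move=> PQ [N [mN N0 sN]]; exists N; split=> // t /= nQ; apply: sN => /= Pt.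
exact/nQ/PQ.
Qed.

Lemma ac_uniform (R : realType) (T : R) (y : R -> R) : ac_on T y ->
  forall e : R, 0 < e -> exists2 d : R, 0 < d & forall s t,
    0 <= s <= T -> 0 <= t <= T -> `|s - t| < d -> `|y s - y t| < e.
Proof.
move=> acy e e0; have [d d0 H] := ac_on_seq acy e0; exists d => // s t.
wlog st : s t / s <= t => [W|] sT tT std.
  case: (leP s t) => [st|/ltW st]; first exact: W.
  by rewrite distrC; apply: W => //; rewrite distrC.
have := H [:: (s, t)]; rewrite !big_seq1 /= distrC; apply => //.
  by move: sT tT => /andP[-> _] /andP[_ ->]; rewrite st.
by move: std; rewrite ler0_norm ?subr_le0// opprB.
Qed.

Lemma ac_bounded (R : realType) (T : R) (y : R -> R) : 0 <= T -> ac_on T y ->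
  exists2 B : R, 0 <= B & forall t, 0 <= t <= T -> `|y t| <= B.
Proof.
move=> T0 acy; have [d d0 Hd] := ac_uniform acy ltr01.
apply: (@gauge_induction _ (fun l r => exists2 B : R, 0 <= B &
  forall t, l <= t <= r -> `|y t| <= B) 0 T) => //.
  move=> l m r _ lm mr _ [B B0 HB] [B' B'0 HB'].
  exists (B + B'); first exact: addr_ge0.
  move=> t /andP[lt_ tr]; case: (leP t m) => tm.
    by rewrite (le_trans (HB t _)) ?lt_// lerDl.
  by rewrite (le_trans (HB' t _)) ?lerDr// (ltW tm).
move=> t /andP[t0 tT]; exists d => // l r l0 lt_ tr rT dl dr.
exists (`|y t| + 1); first by rewrite addr_ge0.
move=> s /andP[ls sr].
have : `|y s - y t| < 1 by apply: Hd; rewrite ?t0 ?tT// ?ltr_norml; lra.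
have := ler_normD (y s - y t) (y t); rewrite subrK; lra.
Qed.

Lemma ac_comp2 (R : realType) (T L : R) (y1 y2 z : R -> R) :
  ac_on T y1 -> ac_on T y2 -> 0 < L ->
  (forall s t, 0 <= s <= T -> 0 <= t <= T ->
     `|z s - z t| <= L * (`|y1 s - y1 t| + `|y2 s - y2 t|)) ->
  ac_on T z.
Proof.
move=> ac1 ac2 L0 zL e e0.
have e'0 : 0 < e / (2 * L) by rewrite divr_gt0// mulr_gt0.
have [d1 d10 H1] := ac1 _ e'0; have [d2 d20 H2] := ac2 _ e'0.
exists (Num.min d1 d2); first by rewrite lt_min d10.
move=> k l r lr dis; rewrite lt_min => /andP[s1 s2].
have {}H1 := H1 k l r lr dis s1; have {}H2 := H2 k l r lr dis s2.
have : \sum_i `|z (r i) - z (l i)| <=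
    L * (\sum_i `|y1 (r i) - y1 (l i)| + \sum_i `|y2 (r i) - y2 (l i)|).
  rewrite -big_split /= mulr_sumr; apply: ler_sum => i _.
  have [l0 [lri rT]] := lr i.
  by apply: zL; rewrite ?(le_trans l0)// ?l0 ?(le_trans lri).
move=> /le_lt_trans; apply.
have -> : e = L * (e / (2 * L) + e / (2 * L)).
  by rewrite -mulr2n -mulr_natl; field; rewrite gt_eqF.
by rewrite ltr_pM2l// ltrD.
Qed.

Lemma ac_cst (R : realType) (T c : R) : ac_on T (fun=> c).
Proof.
move=> e e0; exists 1 => // k l r _ _ _.
by rewrite big1// => i _; rewrite subrr normr0.
Qed.

Lemma ac_id (R : realType) (T : R) : ac_on T id.
Proof.
move=> e e0; exists e => // k l r lr _ H.
rewrite (eq_bigr (fun i => r i - l i)) // => i _.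
by rewrite ger0_norm// subr_ge0; case: (lr i) => _ [].
Qed.

Lemma acD (R : realType) (T : R) (y z : R -> R) : ac_on T y -> ac_on T z ->
  ac_on T (fun t => y t + z t).
Proof.
move=> acy acz; apply: (ac_comp2 acy acz ltr01) => s t _ _.
by rewrite mul1r opprD addrACA ler_normD.
Qed.

Lemma acM (R : realType) (T : R) (y z : R -> R) : 0 <= T -> ac_on T y ->
  ac_on T z -> ac_on T (fun t => y t * z t).
Proof.
move=> T0 acy acz.
have [By By0 HBy] := ac_bounded T0 acy; have [Bz Bz0 HBz] := ac_bounded T0 acz.
have B0 : 0 < By + Bz + 1 by lra.
apply: (ac_comp2 acy acz B0) => s t sT tT.
have -> : y s * z s - y t * z t = (y s - y t) * z s + y t * (z s - z t) by ring.
apply: (le_trans (ler_normD _ _)); rewrite !normrM mulrDr [`|y s - y t| * _]mulrC.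
apply: lerD; apply: ler_wpM2r => //.
  have := HBz s sT; lra.
have := HBy t tT; lra.
Qed.

Lemma acN (R : realType) (T : R) (y : R -> R) : ac_on T y ->
  ac_on T (fun t => - y t).
Proof.
move=> acy; apply: (ac_comp2 acy acy ltr01) => s t _ _.
by rewrite mul1r -opprD normrN lerDl.
Qed.

Lemma acB (R : realType) (T : R) (y z : R -> R) : ac_on T y -> ac_on T z ->
  ac_on T (fun t => y t - z t).
Proof. by move=> acy acz; apply: acD => //; exact: acN. Qed.

(** The last zero before [t] is where a barrier argument starts: to its right
[y] is negative, hence [|y| = - y]. *)
Lemma ac_last_zero (R : realType) (T : R) (y : R -> R) (t : R) : ac_on T y ->
  0 <= y 0 -> 0 <= t <= T -> y t < 0 ->
  exists Z, [/\ 0 <= Z, Z < t, y Z = 0 & forall s, Z < s <= t -> y s < 0].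
Proof.
move=> acy y0 /andP[t0 tT] yt.
pose S := [set s | 0 <= s <= t /\ 0 <= y s].
have S0 : S 0 by split=> //; rewrite lexx.
have supS : has_sup S by split; [exists 0|exists t => s [] /andP[]].
have Z0 : 0 <= sup S by apply: ub_le_sup => //; case: supS.
have Zt : sup S <= t by apply: ge_sup; [exists 0|move=> s [] /andP[]].
have after s : sup S < s <= t -> y s < 0.
  move=> /andP[Zs st]; rewrite ltNge; apply/negP => ys.
  suff : s <= sup S by rewrite leNgt Zs.
  apply: ub_le_sup; first by case: supS.
  by split=> //; rewrite st (le_trans Z0 (ltW Zs)).
have ZT : 0 <= sup S <= T by rewrite Z0 (le_trans Zt).
have yZ : 0 <= y (sup S).
  rewrite leNgt; apply/negP => yZ.
  have [d d0 Hd] := ac_uniform acy (e := - y (sup S)) ltac:(lra).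
  have [s [/andP[s0 st] ys] sZ] := sup_adherent d0 supS.
  have sS : s <= sup S by apply: ub_le_sup; [case: supS|split=> //; rewrite s0].
  have : `|y s - y (sup S)| < - y (sup S).
    apply: Hd => //; first by rewrite s0 (le_trans st).
    by rewrite ltr_norml; lra.
  by rewrite ltr_norml => /andP[]; lra.
have Zlt : sup S < t.
  by rewrite lt_neqAle Zt andbT; apply/eqP => E; move: yZ; rewrite E leNgt yt.
exists (sup S); split=> //; apply/eqP; rewrite eq_le yZ andbT leNgt.
apply/negP => yZ'.
have [d d0 Hd] := ac_uniform acy yZ'.
pose s := Num.min t (sup S + d / 2).
have sZ : sup S < s by rewrite /s lt_min Zlt /=; lra.
have st : s <= t by rewrite /s ge_min lexx.
have sd : s < sup S + d by rewrite /s gt_min; apply/orP; right; lra.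
have := after s; rewrite sZ st => /(_ isT) ys.
have : `|y s - y (sup S)| < y (sup S).
  apply: Hd => //; first by rewrite (le_trans Z0 (ltW sZ)) (le_trans st).
  by rewrite ltr_norml; lra.
by rewrite ltr_norml => /andP[]; lra.
Qed.

(** After its last zero, [y] decreases at speed at most [C B], where [B] is the
supremum of [- y] there; since [C T <= 1 / 2] this yields [B <= B / 2]. *)
Lemma ac_barrier (R : realType) (T C : R) (y : R -> R) :
  ac_on T y -> 0 <= y 0 -> 0 <= C -> C * T <= 1 / 2 ->
  {ae (@lebesgue_measure R), forall t, t \in `[0, T] ->
      exists2 D, - C * `|y t| <= D & is_derive t (1 : R) y D} ->
  forall t, 0 <= t <= T -> 0 <= y t.
Proof.
move=> acy y0 C0 CT dy t tT; rewrite leNgt; apply/negP => yt.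
have [Z [Z0 Zt yZ neg]] := ac_last_zero acy y0 tT yt.
have /andP[t0 tT'] := tT.
have T0 : 0 <= T by apply: le_trans tT'.
have [B B0 HB] := ac_bounded T0 acy.
pose S := [set - y s | s in [set s | Z <= s <= t]].
have St : S (- y t) by exists t => //=; rewrite lexx (ltW Zt).
have supS : has_sup S.
  split; first by exists (- y t).
  exists B => _ [s /= /andP[Zs st] <-].
  have : 0 <= s <= T by rewrite (le_trans Z0 Zs) (le_trans st).
  by move=> /HB; rewrite ler_norml => /andP[]; lra.
have ub s : Z <= s <= t -> - y s <= sup S.
  by move=> H; apply: ub_le_sup; [case: supS|exists s].
have supS0 : 0 < sup S by apply: lt_le_trans (ub t _); rewrite ?(ltW Zt) ?lexx//; lra.
suff : sup S <= sup S / 2 by lra.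
apply: ge_sup; first by exists (- y t).
move=> _ [s /= /andP[Zs st] <-].
have : (- C * sup S) * (s - Z) <= y s - y Z.
  apply: (ac_mean_value acy) => //; first exact: le_trans tT'.
  apply: ae_imply dy => r H; rewrite in_itv /= => /andP[Zr rs].
  have [|D D1 D2] := H; first by rewrite in_itv /= (le_trans Z0 Zr) (le_trans rs)// (le_trans st).
  exists D => //; apply: le_trans D1; rewrite !mulNr lerN2 ler_wpM2l//.
  have [->|/eqP nZr] := eqVneq r Z; first by rewrite yZ normr0 ltW.
  rewrite ltr0_norm.
    by apply: ub; rewrite Zr (le_trans rs).
  by apply: neg; rewrite (le_trans rs st) andbT lt_neqAle Zr andbT eq_sym; apply/eqP.
rewrite yZ subr0.
have : C * (s - Z) <= C * T by rewrite ler_wpM2l//; lra.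
move=> H1; have : C * (s - Z) * sup S <= 1 / 2 * sup S.
  by rewrite ler_pM2r//; lra.
lra.
Qed.

(** * Trajectories starting at the origin *)

Lemma cV_norm_coord (R : realType) (n : nat) (v : 'cV[R]_n.+1) i : `|v i 0| <= `|v|.
Proof. by rewrite [leRHS]/Num.norm /= mx_normrE; apply/bigmax_geP; right => /=; exists (i, 0). Qed.

Lemma cV_norm_le (R : realType) (n : nat) (v : 'cV[R]_n.+1) (e : R) :
  (forall i, `|v i 0| <= e) -> `|v| <= e.
Proof.
move=> H; rewrite [leLHS]/Num.norm /= mx_normrE; apply/bigmax_leP; split.
  exact: le_trans (H 0).
by move=> [i j] _ /=; rewrite ord1.
Qed.

Lemma is_derive_coord (R : realType) (n : nat) (x : R -> 'cV[R]_n.+1) t D :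
  is_derive t (1 : R) x D <->
  forall i, is_derive t (1 : R) (fun s => x s i 0) (D i 0).
Proof.
split.
  move=> /is_deriveE H i; apply/is_deriveE => e e0.
  have [d d0 Hd] := H e e0; exists d => // s std.
  apply: le_trans (Hd s std); apply: le_trans (cV_norm_coord _ i).
  by rewrite !mxE.
move=> H; apply/is_deriveE => e e0.
have H' i : exists d : R, 0 < d /\ forall s, `|s - t| < d ->
    `|x s i 0 - x t i 0 - (s - t) *: D i 0| <= e * `|s - t|.
  by have /is_deriveE/(_ e e0)[d d0 Hd] := H i; exists d.
have {H'}[d Hd] := choice H'.
exists (\big[Num.min/1]_i d i).
  apply: (big_ind (fun z : R => 0 < z)) => //.
    by move=> a b a0 b0; rewrite lt_min a0.
  by move=> i _; case: (Hd i).
move=> s std; apply: cV_norm_le => i; rewrite !mxE.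
apply: (Hd i).2; apply: lt_le_trans std _; exact: bigmin_le_cond.
Qed.

Lemma trajectory_coord (R : realType) (n : nat) (F : 'cV[R]_n.+1 -> 'cV[R]_n.+1)
    (f : 'cV[R]_n.+1) (U : set R) (T : R) (x : R -> 'cV[R]_n.+1) :
  admissible_trajectory F f U T x ->
  (forall i, ac_on T (fun t => x t i 0)) /\
  exists2 u : R -> R, forall t, 0 <= t <= T -> U (u t) &
    {ae (@lebesgue_measure R), forall t : R, t \in `[0, T] -> forall i,
       is_derive t (1 : R) (fun s => x s i 0) (F (x t) i 0 + u t * f i 0)}.
Proof.
move=> [acx [u [uU _] dx]]; split.
  move=> i e e0; have [d d0 H] := acx e e0; exists d => // k l r lr dis s.
  apply: le_lt_trans (H k l r lr dis s); apply: ler_sum => j _.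
  by apply: le_trans (cV_norm_coord _ i); rewrite !mxE.
exists u; first by move=> t tT; apply: uU; rewrite in_itv.
apply: ae_imply dx => t H tT i.
by have /is_derive_coord/(_ i) := H tT; rewrite !mxE.
Qed.

(** As long as the trajectory stays in the unit ball its speed is at most [M], so
it stays in the ball of radius [M T <= 1 / 2]; by continuity it cannot leave. *)
Lemma trajectory_small (R : realType) (n : nat) (F : 'cV[R]_n.+1 -> 'cV[R]_n.+1)
    (f : 'cV[R]_n.+1) (U : set R) (T M e : R) (x : R -> 'cV[R]_n.+1) :
  admissible_trajectory F f U T x -> x 0 = 0 -> 0 <= T ->
  (forall z u, `|z| <= 1 -> U u -> `|F z + u *: f| <= M) ->
  M * T <= e -> e <= 1 / 2 ->
  forall t, 0 <= t <= T -> `|x t| <= e.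
Proof.
move=> tx x0 T0 FM MT e2.
have [acx [u uU dx]] := trajectory_coord tx.
have M0 : 0 <= M.
  apply: le_trans (FM 0 (u 0) _ _) => //; first by rewrite normr0.
  by apply: uU; rewrite lexx.
have mv r : 0 <= r <= T -> (forall s, 0 <= s <= r -> `|x s| <= 1) -> `|x r| <= e.
  move=> /andP[r0 rT] xs; apply: le_trans MT.
  apply: (@le_trans _ _ (M * r)); last by rewrite ler_wpM2l.
  have dB i : {ae (@lebesgue_measure R), forall t, t \in `[0, r] ->
      exists D, `|D| <= M /\ is_derive t (1 : R) (fun s => x s i 0) D}.
    apply: ae_imply dx => t H; rewrite in_itv /= => /andP[t0 tr].
    have tT : 0 <= t <= T by rewrite t0 (le_trans tr).
    have := H; rewrite in_itv /= => /(_ tT i) Hi.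
    eexists; split; last exact: Hi.
    apply: le_trans (FM (x t) (u t) _ _); last exact: uU.
      by apply: le_trans (cV_norm_coord _ i); rewrite !mxE.
    by apply: xs; rewrite t0.
  apply: cV_norm_le => i; rewrite ler_norml; apply/andP; split.
    have := @ac_mean_value _ T (fun s => x s i 0) (- M) 0 r (acx i) (lexx _) r0 rT.
    rewrite x0 mxE !subr0 mulNr; apply.
    apply: ae_imply (dB i) => t H /H[D [DM dD]]; exists D => //.
    by move: DM; rewrite ler_norml => /andP[].
  have := @ac_mean_value _ T (fun s => - x s i 0) (- M) 0 r (acN (acx i)) (lexx _) r0 rT.
  rewrite x0 mxE !oppr0 !addr0 mulNr lerN2; apply.
  apply: ae_imply (dB i) => t H /H[D [DM dD]]; exists (- D) => //.
    by move: DM; rewrite ler_norml lerN2 => /andP[].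
  exact: is_deriveN.
suff key : forall s, 0 <= s <= T -> `|x s| <= 1.
  move=> t /andP[t0 tT]; apply: mv; first by rewrite t0.
  by move=> s /andP[s0 st]; apply: key; rewrite s0 (le_trans st).
have acx' : ac_on T (fun t => `|x t|).
  move=> a a0; have [d d0 H] := tx.1 a a0; exists d => // k l r lr dis s.
  apply: le_lt_trans (H k l r lr dis s); apply: ler_sum => j _.
  exact: ler_dist_dist.
have [d d0 Hd] := ac_uniform acx' (e := 1 / 2) ltac:(lra).
(* The bound by 1 propagates over intervals on which the norm varies by less
   than 1 / 2, because the speed estimate improves it to [e] first. *)
suff : (forall s, 0 <= s <= 0 -> `|x s| <= 1) -> forall s, 0 <= s <= T -> `|x s| <= 1.
  by move=> H; apply: H => s s0; rewrite (_ : s = 0) ?x0 ?normr0//; lra.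
apply: (@gauge_induction _ (fun l r => (forall s, 0 <= s <= l -> `|x s| <= 1) ->
   forall s, 0 <= s <= r -> `|x s| <= 1) 0 T) => //.
  by move=> l m r _ _ _ _ H1 H2 /H1/H2.
move=> t /andP[t0 tT]; exists (d / 2); first by lra.
move=> l r l0 lt_ tr rT dl dr xl s /andP[s0 sr].
have [sl|ls] := leP s l; first by apply: xl; rewrite s0.
have lT : 0 <= l <= T by rewrite l0 (le_trans lt_).
have := mv l lT xl.
have : `| `|x s| - `|x l| | < 1 / 2.
  by apply: Hd => //; rewrite ?s0 ?(le_trans sr)// ltr_norml; lra.
by rewrite ltr_norml => /andP[]; lra.
Qed.

(** * The second-order obstruction *)

(* Pointwise forms of the rules, to be composed along explicit expressions. *)
Lemma is_deriveD_fun (R : realType) (t : R) (y z : R -> R) dy dz :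
  is_derive t (1 : R) y dy -> is_derive t (1 : R) z dz ->
  is_derive t (1 : R) (fun s => y s + z s) (dy + dz).
Proof. by move=> ? ?; apply: is_deriveD. Qed.

Lemma is_deriveB_fun (R : realType) (t : R) (y z : R -> R) dy dz :
  is_derive t (1 : R) y dy -> is_derive t (1 : R) z dz ->
  is_derive t (1 : R) (fun s => y s - z s) (dy - dz).
Proof. by move=> ? ?; apply: is_deriveB. Qed.

Lemma is_deriveM_fun (R : realType) (t : R) (y z : R -> R) dy dz :
  is_derive t (1 : R) y dy -> is_derive t (1 : R) z dz ->
  is_derive t (1 : R) (fun s => y s * z s) (dy * z t + y t * dz).
Proof.
move=> hy hz; apply: (@is_derive_eq _ _ _ (y * z)).
by rewrite /GRing.scale /= addrC [z t * _]mulrC.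
Qed.

(** Completing the square: [2 w g] is at least
[- 2 P |z| |w| - 2 P w^2], and [z^2 / 4 - 2 P |z| |w| + 4 P^2 w^2] is a square. *)
Lemma definite_form (R : realType) (z w g e P : R) :
  0 <= P -> `|g| <= P * (`|z| + `|w|) ->
  2 * P + 4 * P ^+ 2 <= e ->
  0 <= z ^+ 2 / 4 + e * w ^+ 2 + 2 * w * g.
Proof.
move=> P0 gP eP.
have h : - (`|w| * (P * (`|z| + `|w|))) <= w * g.
  have : `|w * g| <= `|w| * (P * (`|z| + `|w|)) by rewrite normrM ler_wpM2l.
  by rewrite ler_norml => /andP[].
have w2 : w ^+ 2 = `|w| ^+ 2 by rewrite real_normK ?num_real.
have z2 : z ^+ 2 = `|z| ^+ 2 by rewrite real_normK ?num_real.
have h2 : (2 * P + 4 * P ^+ 2) * w ^+ 2 <= e * w ^+ 2.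
  by rewrite ler_wpM2r// sqr_ge0.
have := sqr_ge0 (`|z| / 2 - 2 * P * `|w|).
move: h h2; rewrite z2 w2 => h h2.
move: h h2; set Z := `|z|; set W := `|w|.
lra.
Qed.

Lemma small_time (R : realType) (C : R) : 0 <= C ->
  exists2 T0 : R, 0 < T0 & forall T, 0 <= T -> T <= T0 -> C * T <= 1 / 2.
Proof.
move=> C0; exists (2 * (C + 1))^-1; first by rewrite invr_gt0; lra.
move=> T T0 TC; apply: (@le_trans _ _ ((C + 1) * T)).
  by rewrite ler_wpM2r//; lra.
rewrite mulrC -ler_pdivlMr; last by lra.
by apply: le_trans TC _; rewrite invfM mul1r.
Qed.

(** With [w = fb a - fa b] and [z = fb a + fa b], the product [fa fb a b] is
[(z^2 - w^2) / 4], so the derivative of [k q + K t w^2] contains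
[z^2 / 4 + (K - 1/4) w^2]. The remaining terms are bounded multiples of
[w a], [w b] and [w q] carrying a factor [K t <= 1]; the first two are absorbed
for [K] large, and the last is rewritten through [k q = y - K t w^2].
The control disappears because [fb a' - fa b'] does not contain it. *)
Lemma quadratic_obstruction (R : realType) (fa fb c s L : R) :
  fa != 0 -> fb != 0 -> s * s = 1 -> 0 <= L ->
  exists2 K : R, 0 <= K & exists2 T0 : R, 0 < T0 &
  forall (T : R) (a b q : R -> R), 0 <= T -> T <= T0 ->
    ac_on T a -> ac_on T b -> ac_on T q -> a 0 = 0 -> b 0 = 0 -> q 0 = 0 ->
    (forall t, 0 <= t <= T -> `|a t| <= 1 /\ `|b t| <= 1) ->
    {ae (@lebesgue_measure R), forall t, t \in `[0, T] ->
       exists a' b' l1 l2 l3 : R,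
       [/\ is_derive t (1 : R) a a', is_derive t (1 : R) b b',
           is_derive t (1 : R) q (c * q t + s * (a t * b t)),
           fb * a' - fa * b' = l1 * a t + l2 * b t + l3 * q t &
           [/\ `|l1| <= L, `|l2| <= L & `|l3| <= L]]} ->
    forall t, 0 <= t <= T ->
      0 <= s * fa * fb * q t + K * t * (fb * a t - fa * b t) ^+ 2.
Proof.
move=> fa0 fb0 ss L0.
have s0 : s != 0 by apply/eqP => s0; move: ss; rewrite s0 mul0r => /eqP; rewrite eq_sym oner_eq0.
set k := s * fa * fb.
have k0 : k != 0 by rewrite /k !mulf_neq0.
have nk0 : 0 < `|k| by rewrite normr_gt0.
pose W0 := `|fa| + `|fb|.
have W00 : 0 <= W0 by rewrite addr_ge0.
(* [P] bounds [l1 a + l2 b] in terms of [z] and [w]; [Q] bounds the coefficient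
   of [y] coming from [l3]. *)
pose P := L * (`|fb|^-1 + `|fa|^-1).
have P0 : 0 <= P by rewrite mulr_ge0// addr_ge0// invr_ge0.
pose Q := 2 * W0 * L / `|k|.
have Q0 : 0 <= Q by rewrite !mulr_ge0// invr_ge0 ltW.
pose C := `|c| + Q.
have C0 : 0 <= C by rewrite addr_ge0.
pose K := 1 / 4 + C + (2 * P + 4 * P ^+ 2).
have K0 : 0 < K.
  have : 0 <= P ^+ 2 by exact: sqr_ge0.
  rewrite /K; lra.
exists K; first exact: ltW.
have [T1 T10 HT1] := small_time C0.
exists (Num.min K^-1 T1); first by rewrite lt_min invr_gt0 K0.
move=> T a b q T0; rewrite le_min => /andP[TK TC] aca acb acq a0 b0 q0 ab1 dd.
have KT : K * T <= 1 by rewrite mulrC -ler_pdivlMr// mul1r.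
have CT : C * T <= 1 / 2 by exact: HT1.
pose w t := fb * a t - fa * b t.
pose y t := k * q t + (K * t) * (w t * w t).
have acw : ac_on T w.
  by apply: acB; apply: acM => //; apply: ac_cst.
have acy : ac_on T y.
  apply: acD; apply: acM => //; first exact: ac_cst.
    by apply: acM => //; [exact: ac_cst|exact: ac_id].
  exact: acM.
suff H : forall t, 0 <= t <= T -> 0 <= y t.
  by move=> t /H; rewrite /y expr2.
apply: (ac_barrier acy _ C0 CT); first by rewrite /y q0 !mulr0 mul0r addr0.
apply: ae_imply dd => t H tT.
have [a' [b' [l1 [l2 [l3 [da db dq E [L1 L2 L3]]]]]]] := H tT.
move: tT; rewrite in_itv /= => tT; have /andP[t0 tT'] := tT.
have [a1 b1] := ab1 t tT.
have w1 : `|w t| <= W0.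
  apply: le_trans (ler_normB _ _) _; rewrite !normrM /W0 addrC.
  by apply: lerD; rewrite ler_piMr.
have dw : is_derive t (1 : R) w (l1 * a t + l2 * b t + l3 * q t).
  have := is_deriveB_fun (is_deriveM_fun (is_derive_cst fb t 1) da)
    (is_deriveM_fun (is_derive_cst fa t 1) db).
  by rewrite !mul0r !add0r E.
have dKt : is_derive t (1 : R) (fun s => K * s) K.
  have := is_deriveM_fun (is_derive_cst K t 1) (is_derive_id t 1).
  by rewrite mul0r add0r mulr1.
have dy := is_deriveD_fun (is_deriveM_fun (is_derive_cst k t 1) dq)
  (is_deriveM_fun dKt (is_deriveM_fun dw dw)).
pose r := c + 2 * (K * t) * w t * l3 / k.
pose z := fb * a t + fa * b t.
pose g := (K * t) * (l1 * a t + l2 * b t).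
pose e := K - 1 / 4 - c * (K * t) - 2 * (K * t) ^+ 2 * w t * l3 / k.
have Kt0 : 0 <= K * t by rewrite mulr_ge0// ltW.
have Kt1 : K * t <= 1 by apply: le_trans KT; rewrite ler_wpM2l// ltW.
have wl : `|2 * w t * l3 / k| <= Q.
  rewrite !normrM normfV (ger0_norm (x := 2))// /Q.
  apply: ler_wpM2r; first by rewrite invr_ge0 ltW.
  by rewrite -!mulrA ler_wpM2l// ler_pM.
eexists; last exact: dy.
rewrite mul0r add0r.
have -> : k * (c * q t + s * (a t * b t)) + (K * (w t * w t) + K * t *
    ((l1 * a t + l2 * b t + l3 * q t) * w t + w t * (l1 * a t + l2 * b t + l3 * q t)))
  = r * y t + (z ^+ 2 / 4 + e * w t ^+ 2 + 2 * w t * g).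
  rewrite /r /y /e /g; set W := w t.
  have kE : k * (s * (a t * b t)) = (fb * a t) * (fa * b t).
    by rewrite /k; transitivity ((s * s) * (fb * a t) * (fa * b t)); [ring|rewrite ss mul1r].
  have zw : (fb * a t) * (fa * b t) = (z ^+ 2 - W ^+ 2) / 4 by rewrite /z /W /w; field.
  rewrite mulrDr kE zw; clearbody W z; clear -k0; by field.
have r1 : `|r| <= C.
  rewrite /r; apply: le_trans (ler_normD _ _) _; rewrite /C lerD2l.
  have -> : 2 * (K * t) * w t * l3 / k = (K * t) * (2 * w t * l3 / k) by ring.
  rewrite normrM (ger0_norm Kt0); apply: le_trans wl; rewrite ler_piMl//.
have ry : - C * `|y t| <= r * y t.
  have : `|r * y t| <= C * `|y t| by rewrite normrM ler_wpM2r.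
  by rewrite ler_norml mulNr => /andP[].
have e1 : 2 * P + 4 * P ^+ 2 <= e.
  have h1 : c * (K * t) <= `|c|.
    apply: le_trans (ler_norm _) _; rewrite normrM (ger0_norm Kt0) ler_piMr//.
  have h2 : 2 * (K * t) ^+ 2 * w t * l3 / k <= Q.
    have -> : 2 * (K * t) ^+ 2 * w t * l3 / k = (K * t) ^+ 2 * (2 * w t * l3 / k) by ring.
    apply: le_trans (ler_norm _) _; rewrite normrM ger0_norm ?sqr_ge0//.
    by apply: le_trans wl; rewrite ler_piMl// exprn_ile1.
  have : K = 1 / 4 + (`|c| + Q) + (2 * P + 4 * P ^+ 2) by [].
  rewrite /e; clear -h1 h2; move: h1 h2; rewrite expr2; clearbody K Q P => h1 h2 KE. lra.
have g1 : `|g| <= P * (`|z| + `|w t|).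
  have aE : a t = (z + w t) / (2 * fb) by rewrite /z /w; field.
  have bE : b t = (z - w t) / (2 * fa) by rewrite /z /w; field.
  have la : `|a t| <= `|fb|^-1 * (`|z| + `|w t|).
    rewrite aE normrM normfV normrM mulrC (ger0_norm (x := 2))// invfM.
    apply: ler_pM => //.
      by rewrite ler_piMl ?invr_ge0// invf_le1 ?ler1n.
    exact: ler_normD.
  have lb : `|b t| <= `|fa|^-1 * (`|z| + `|w t|).
    rewrite bE normrM normfV normrM mulrC (ger0_norm (x := 2))// invfM.
    apply: ler_pM => //.
      by rewrite ler_piMl ?invr_ge0// invf_le1 ?ler1n.
    exact: ler_normB.
  rewrite /g normrM (ger0_norm Kt0).
  apply: (@le_trans _ _ `|l1 * a t + l2 * b t|); first by rewrite ler_piMl.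
  apply: le_trans (ler_normD _ _) _; rewrite !normrM /P -mulrA mulrDl mulrDr.
  by apply: lerD; apply: ler_pM.
have := definite_form P0 g1 e1; lra.
Qed.

(** * Exceptional control vectors *)

Lemma bounded_set_bound (R : realType) (U : set R) : bounded_set U ->
  exists2 B : R, 0 <= B & forall u, U u -> `|u| <= B.
Proof.
move=> [B [_ HB]]; exists (`|B| + 1); first by rewrite addr_ge0.
by move=> u Uu; apply: HB => //; rewrite (le_lt_trans (ler_norm B))// ltrDl.
Qed.

Lemma lorenz_driftE (R : realType) (beta sigma rho : R) (z : 'cV[R]_3) :
  [/\ lorenz_drift beta sigma rho z 0 0 = - sigma * z 0 0 + sigma * z 1 0,
      lorenz_drift beta sigma rho z 1 0 =
        rho * z 0 0 - z 1 0 - z 0 0 * z 2 0 &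
      lorenz_drift beta sigma rho z 2 0 = - beta * z 2 0 + z 0 0 * z 1 0].
Proof.
rewrite /lorenz_drift !mxE !big_ord_recl !big_ord0 !mxE /=.
have -> : lift ord0 (ord0 : 'I_2) = 1 :> 'I_3 by apply/val_inj.
have -> : lift ord0 (lift ord0 (ord0 : 'I_1)) = 2 :> 'I_3 by apply/val_inj.
by split; ring.
Qed.

Lemma ord3P (P : 'I_3 -> Prop) : P 0 -> P 1 -> P 2 -> forall i, P i.
Proof.
move=> P0 P1 P2 [[|[|[|//]]] Hi].
- by rewrite (_ : Ordinal Hi = 0)//; apply/val_inj.
- by rewrite (_ : Ordinal Hi = 1)//; apply/val_inj.
- by rewrite (_ : Ordinal Hi = 2)//; apply/val_inj.
Qed.

(** The coordinates of a trajectory from 0 that stays within [e] of it. The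
control only enters through an unspecified value [u], as each obstruction
eliminates it. *)
Definition lorenz_arc (R : realType) (beta sigma rho : R) (f : 'cV[R]_3)
    (T e : R) (x1 x2 x3 : R -> R) : Prop :=
  [/\ [/\ ac_on T x1, ac_on T x2 & ac_on T x3],
      [/\ x1 0 = 0, x2 0 = 0 & x3 0 = 0],
      forall t, 0 <= t <= T -> [/\ `|x1 t| <= e, `|x2 t| <= e & `|x3 t| <= e] &
      {ae (@lebesgue_measure R), forall t, t \in `[0, T] -> exists u : R,
        [/\ is_derive t (1 : R) x1 (- sigma * x1 t + sigma * x2 t + u * f 0 0),
            is_derive t (1 : R) x2
              (rho * x1 t - x2 t - x1 t * x3 t + u * f 1 0) &
            is_derive t (1 : R) x3 (- beta * x3 t + x1 t * x2 t + u * f 2 0)]}].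

Lemma lorenz_arcP (R : realType) (beta sigma rho e : R) (f : 'cV[R]_3)
    (U : set R) : bounded_set U -> 0 < e -> e <= 1 / 2 ->
  exists2 T0 : R, 0 < T0 & forall T x, 0 <= T -> T <= T0 ->
    admissible_trajectory (lorenz_drift beta sigma rho) f U T x -> x 0 = 0 ->
    lorenz_arc beta sigma rho f T e (fun t => x t 0 0) (fun t => x t 1 0)
      (fun t => x t 2 0).
Proof.
move=> /bounded_set_bound[B B0 HB] e0 e2.
pose M0 := `|sigma| + `|rho| + `|beta| + `|sigma| + 2.
pose M := M0 + B * `|f| + 1.
have M00 : 0 <= M0 by rewrite !addr_ge0.
have Mp : 0 < M by rewrite ltr_wpDl// addr_ge0// mulr_ge0.
exists (e / M); first exact: divr_gt0.
move=> T x T0 TM tx x0.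
have FM (z : 'cV[R]_3) u : `|z| <= 1 -> U u ->
    `|lorenz_drift beta sigma rho z + u *: f| <= M.
  move=> z1 Uu.
  have FM0 : `|lorenz_drift beta sigma rho z| <= M0.
    have zi i : `|z i 0| <= 1 by apply: le_trans z1; exact: cV_norm_coord.
    have m1 a i : `|a * z i 0| <= `|a| by rewrite normrM ler_piMr.
    have m2 i j : `|z i 0 * z j 0| <= 1 by rewrite normrM mulr_ile1.
    have [E0 E1 E2] := lorenz_driftE beta sigma rho z.
    have ha := normr_ge0 sigma; have hb := normr_ge0 rho; have hc := normr_ge0 beta.
    apply: cV_norm_le; apply: ord3P; rewrite ?E0 ?E1 ?E2 /M0.
    - have := m1 (- sigma) 0; have := m1 sigma 1; rewrite normrN => h1 h2.
      have := ler_normD (- sigma * z 0 0) (sigma * z 1 0); lra.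
    - have := m1 rho 0; have := zi 1; have := m2 0 2 => h1 h2 h3.
      have := ler_normB (rho * z 0 0 - z 1 0) (z 0 0 * z 2 0).
      have := ler_normB (rho * z 0 0) (z 1 0); lra.
    - have := m1 (- beta) 2; have := m2 0 1; rewrite normrN => h1 h2.
      have := ler_normD (- beta * z 2 0) (z 0 0 * z 1 0); lra.
  apply: le_trans (ler_normD _ _) _; rewrite normrZ /M.
  have : `|u| * `|f| <= B * `|f| by rewrite ler_wpM2r// HB.
  lra.
have MT : M * T <= e by rewrite mulrC -ler_pdivlMr.
have small := trajectory_small tx x0 T0 FM MT e2.
have [acx [u _ dx]] := trajectory_coord tx.
split; rewrite ?x0 ?mxE //.
  by move=> t /small xt; split; apply: le_trans xt; exact: cV_norm_coord.
apply: ae_imply dx => t H /H Hi; exists (u t).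
have [E0 E1 E2] := lorenz_driftE beta sigma rho (x t).
by move: (Hi 0) (Hi 1) (Hi 2); rewrite E0 E1 E2.
Qed.

Lemma not_STLC (R : realType) (n : nat) (F : 'cV[R]_n.+1 -> 'cV[R]_n.+1) f U
    (G : 'cV[R]_n.+1 -> Prop) (T0 : R) : 0 < T0 ->
  (forall T x, 0 <= T -> T <= T0 -> admissible_trajectory F f U T x -> x 0 = 0 ->
     G (x T)) ->
  (forall e : R, 0 < e -> exists2 q, `|q| < e & ~ G q) ->
  ~ STLC F f U 0.
Proof.
move=> T00 FG nG /(_ T0 T00) /nbhs_ballP[e /= e0 He].
have [q qe nq] := nG e e0; apply: nq.
have [|t /andP[t0 tT] [x [tx x0 xt]]] := He q.
  by rewrite -ball_normE /= sub0r normrN.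
by rewrite -xt; exact: FG tx x0.
Qed.

Lemma vec3E (R : realType) (a b c : R) :
  [/\ vec3 a b c 0 0 = a, vec3 a b c 1 0 = b & vec3 a b c 2 0 = c].
Proof. by rewrite /vec3 !mxE. Qed.

Lemma not_STLC_lorenz (R : realType) (beta sigma rho e T0 : R) (f : 'cV[R]_3)
    (U : set R) (G : R -> R -> R -> Prop) :
  bounded_set U -> 0 < e -> e <= 1 / 2 -> 0 < T0 ->
  (forall T x1 x2 x3, 0 <= T -> T <= T0 ->
     lorenz_arc beta sigma rho f T e x1 x2 x3 -> G (x1 T) (x2 T) (x3 T)) ->
  (forall dl : R, 0 < dl -> exists q1 q2 q3,
     [/\ `|q1| < dl, `|q2| < dl, `|q3| < dl & ~ G q1 q2 q3]) ->
  ~ STLC (lorenz_drift beta sigma rho) f U 0.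
Proof.
move=> bU e0 e2 T00 HG nG.
have [T1 T10 arc] := lorenz_arcP beta sigma rho f bU e0 e2.
apply: (@not_STLC _ _ _ _ _ (fun q : 'cV[R]_3 => G (q 0 0) (q 1 0) (q 2 0))
  (Num.min T0 T1)); first by rewrite lt_min T00.
  move=> T x Tge; rewrite le_min => /andP[TT0 TT1] tx x0.
  exact: HG (arc T x Tge TT1 tx x0).
move=> d d0; have d20 : 0 < d / 2 by rewrite divr_gt0.
have [q1 [q2 [q3 [h1 h2 h3 nq]]]] := nG (d / 2) d20.
have [E0 E1 E2] := vec3E q1 q2 q3.
exists (vec3 q1 q2 q3); last by rewrite E0 E1 E2.
apply: (@le_lt_trans _ _ (d / 2)); last by lra.
by apply: cV_norm_le; apply: ord3P; rewrite ?E0 ?E1 ?E2 ltW.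
Qed.

(** The axis is invariant: [x1^2 + x2^2] satisfies a linear differential
inequality and vanishes initially. *)
Lemma not_STLC_e3 (R : realType) (beta sigma rho : R) (f : 'cV[R]_3) (U : set R) :
  0 < sigma -> 0 < rho -> bounded_set U -> f 0 0 = 0 -> f 1 0 = 0 ->
  ~ STLC (lorenz_drift beta sigma rho) f U 0.
Proof.
move=> s0 r0 bU f1 f2.
have C0 : 0 <= sigma + rho + 1 by lra.
have [T0 T00 HT] := small_time C0.
apply: (@not_STLC_lorenz _ _ _ _ (1 / 2) T0 _ _
  (fun q1 q2 _ => 0 <= - (q1 * q1 + q2 * q2)) bU _ _ T00); rewrite ?divr_gt0//.
  move=> T x1 x2 x3 Tge TT0 [[ac1 ac2 ac3] [i1 i2 i3] bd dx].
  pose y t := - (x1 t * x1 t + x2 t * x2 t).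
  have acy : ac_on T y by apply/acN/acD; apply: acM.
  apply: (@ac_barrier _ T _ y acy _ C0 (HT T Tge TT0)); last by rewrite Tge lexx.
    by rewrite /y i1 i2 !mul0r addr0 oppr0.
  apply: ae_imply dx => t H tT; have [u [d1 d2 _]] := H tT.
  move: tT; rewrite in_itv /= => /bd[b1 b2 b3].
  eexists; last exact: is_deriveN (is_deriveD_fun (is_deriveM_fun d1 d1) (is_deriveM_fun d2 d2)).
  rewrite f1 f2 !mulr0 !addr0 /y normrN ger0_norm; last first.
    by rewrite addr_ge0// -expr2 sqr_ge0.
  have h1 := sqr_ge0 (x1 t - x2 t); have h2 := sqr_ge0 (x1 t + x2 t).
  have h3 : `|x1 t * x2 t * x3 t| <= `|x1 t * x2 t|.
    by rewrite normrM ler_piMr//; lra.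
  have h4 : 2 * `|x1 t * x2 t| <= x1 t * x1 t + x2 t * x2 t.
    case: (ger0P (x1 t * x2 t)) => _; rewrite !expr2 in h1 h2; lra.
  have h5 : - `|x1 t * x2 t| <= x1 t * x2 t * x3 t.
    by move: h3; rewrite ler_norml => /andP[].
  have h6 : (sigma + rho) * (2 * (x1 t * x2 t)) <=
     (sigma + rho) * (x1 t * x1 t + x2 t * x2 t).
    apply: ler_wpM2l; first by lra.
    by apply: le_trans h4; rewrite ler_wpM2l ?ler_norm.
  have h7 : 0 <= sigma * (x1 t * x1 t) by apply: mulr_ge0; [exact: ltW|rewrite -expr2 sqr_ge0].
  have h8 : 0 <= x2 t * x2 t by rewrite -expr2 sqr_ge0.
  lra.
move=> d d0; exists (d / 2), 0, 0; rewrite normr0 ger0_norm; last by lra.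
split=> //; first by lra.
have : 0 < d / 2 * (d / 2) by rewrite mulr_gt0// divr_gt0.
by move=> h /=; apply/negP; rewrite -ltNge; lra.
Qed.

(** Since [x2 = x1' / sigma + x1], the product [x1 x2] is, up to
[x1^2], the derivative of [x1^2 / (2 sigma)]. Subtracting the latter from [x3]
leaves [y' = - beta y + (1 - beta / (2 sigma)) x1^2]. *)
Lemma not_STLC_f1_f3 (R : realType) (beta sigma rho : R) (f : 'cV[R]_3) (U : set R) :
  0 < beta -> 0 < sigma -> bounded_set U -> f 0 0 = 0 -> f 2 0 = 0 ->
  ~ STLC (lorenz_drift beta sigma rho) f U 0.
Proof.
move=> be0 s0 bU f1 f3.
have C0 : 0 <= beta by lra.
have [T0 T00 HT] := small_time C0.
have [g [g1 gs]] : exists g : R, g * g = 1 /\ 0 <= g * (1 - beta / (2 * sigma)).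
  case: (lerP 0 (1 - beta / (2 * sigma))) => h; [exists 1|exists (-1)]; split; lra.
apply: (@not_STLC_lorenz _ _ _ _ (1 / 2) T0 _ _
  (fun q1 q2 q3 => 0 <= g * (q3 - (2 * sigma)^-1 * (q1 * q1))) bU _ _ T00); rewrite ?divr_gt0//.
  move=> T x1 x2 x3 Tge TT0 [[ac1 ac2 ac3] [i1 i2 i3] bd dx].
  pose y t := g * (x3 t - (2 * sigma)^-1 * (x1 t * x1 t)).
  have acy : ac_on T y.
    apply: acM => //; first exact: ac_cst.
    by apply: acB => //; apply: acM => //; [exact: ac_cst|exact: acM].
  apply: (@ac_barrier _ T _ y acy _ C0 (HT T Tge TT0)); last by rewrite Tge lexx.
    by rewrite /y i1 i3 !mulr0 subr0 mulr0.
  apply: ae_imply dx => t H tT; have [u [d1 d2 d3]] := H tT.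
  eexists; last exact: is_deriveM_fun (is_derive_cst g t 1) (is_deriveB_fun d3
    (is_deriveM_fun (is_derive_cst (2 * sigma)^-1 t 1) (is_deriveM_fun d1 d1))).
  rewrite f1 f3 !mulr0 !addr0.
  set D := (X in _ <= X).
  have -> : D = - beta * y t + g * (1 - beta / (2 * sigma)) * (x1 t * x1 t).
    by rewrite /D /y /=; field; rewrite gt_eqF.
  have : 0 <= g * (1 - beta / (2 * sigma)) * (x1 t * x1 t).
    by rewrite mulr_ge0// -expr2 sqr_ge0.
  have : beta * y t <= beta * `|y t| by rewrite ler_wpM2l// ler_norm.
  lra.
move=> d d0; exists 0, 0, (- g * (d / 2)).
have ng : `|g| = 1.
  apply/eqP; rewrite -(@eqrXn2 _ 2)//; first by rewrite real_normK ?num_real// expr2 g1 expr1n.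
rewrite normr0 !normrM normrN ng (ger0_norm (x := d)); last by lra.
split=> //; first by rewrite normfV ger0_norm//; lra.
rewrite /= !mulr0 subr0 mulrA mulrN g1; apply/negP; rewrite -ltNge; lra.
Qed.

(** The curves [Y = constant] are circles centred at [(p2, p3) = (0, rho)].
With [Y = 2 rho p3 - p3^2 - p2^2] one has [p3 = (Y + p2^2) / (2 rho - p3)], so
the right-hand side is a bounded multiple of [Y] plus
[2 (1 - beta (rho - p3) / (2 rho - p3)) p2^2]. Near the origin the coefficient
tends to [2 - beta], whose sign is [g]. When [beta = 2] the coefficient is
[2 p3 / (2 rho - p3)], and substituting [p3] once more leaves a nonnegative
multiple of [p2^4]. *)
Lemma circle_decay (R : realType) (beta rho : R) : 0 < beta -> 0 < rho ->
  exists g e C : R, [/\ g * g = 1, 0 < e, e <= 1 / 2, 0 <= C &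
    forall p2 p3 : R, `|p2| <= e -> `|p3| <= e ->
      - C * `|g * (2 * rho * p3 - p3 * p3 - p2 * p2)| <=
      g * (2 * (p2 * p2) - 2 * beta * ((rho - p3) * p3))].
Proof.
move=> b0 r0.
have main (g e C : R) : g * g = 1 -> 0 < e -> e <= rho -> e <= 1 / 2 -> 0 <= C ->
   (forall p2 p3 : R, `|p2| <= e -> `|p3| <= e ->
     exists r s : R, [/\ `|r| <= C, 0 <= g * s &
       2 * (p2 * p2) - 2 * beta * ((rho - p3) * p3) =
       r * (2 * rho * p3 - p3 * p3 - p2 * p2) + s]) ->
   exists g e C : R, [/\ g * g = 1, 0 < e, e <= 1 / 2, 0 <= C &
    forall p2 p3 : R, `|p2| <= e -> `|p3| <= e ->
      - C * `|g * (2 * rho * p3 - p3 * p3 - p2 * p2)| <=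
      g * (2 * (p2 * p2) - 2 * beta * ((rho - p3) * p3))].
  move=> gg e0 er e2 C0 H; exists g, e, C; split=> // p2 p3 h2 h3.
  have [r [s [rC gs ->]]] := H p2 p3 h2 h3.
  set Y := 2 * rho * p3 - p3 * p3 - p2 * p2.
  have : `|r * (g * Y)| <= C * `|g * Y| by rewrite normrM ler_wpM2r.
  by rewrite ler_norml => /andP[h _]; lra.
have bnd e p3 : e <= rho -> `|p3| <= e -> 0 < e ->
    [/\ rho <= 2 * rho - p3, `|(rho - p3) / (2 * rho - p3)| <= 1 &
        `|p3 / (2 * rho - p3)| <= e / rho].
  move=> er; rewrite ler_norml => /andP[h1 h2] e0.
  have d0 : 0 < 2 * rho - p3 by lra.
  split; first by lra.
    by rewrite normrM normfV (gtr0_norm d0) ler_pdivrMr// mul1r ger0_norm; lra.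
  rewrite normrM normfV (gtr0_norm d0).
  apply: ler_pM => //; first by rewrite invr_ge0 ltW.
    by rewrite ler_norml h1.
  by rewrite lef_pV2 ?posrE//; lra.
have [b2|nb2] := eqVneq beta 2.
  pose e := Num.min rho (1 / 2).
  have e0 : 0 < e by rewrite lt_min r0 divr_gt0.
  have er : e <= rho by rewrite ge_min lexx.
  have e2 : e <= 1 / 2 by rewrite ge_min lexx orbT.
  clearbody e.
  pose C := 4 + 2 / rho ^+ 2.
  have C0 : 0 <= C by rewrite addr_ge0// divr_ge0// sqr_ge0.
  apply: (main 1 e C) => //; first by rewrite mulr1.
  move=> p2 p3 h2 h3; have [d1 d2 _] := bnd e p3 er h3 e0.
  have d0 : 2 * rho - p3 != 0 by rewrite gt_eqF//; lra.
  exists (- 4 * ((rho - p3) / (2 * rho - p3)) + 2 * ((p2 * p2) / (2 * rho - p3) ^+ 2)).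
  exists (2 * ((p2 * p2) / (2 * rho - p3)) ^+ 2); split.
  - apply: le_trans (ler_normD _ _) _; apply: lerD.
      rewrite normrM normrN (ger0_norm (x := 4))//; lra.
    rewrite normrM (ger0_norm (x := 2))// ler_wpM2l//.
    rewrite ger0_norm; last by rewrite divr_ge0// -?expr2 sqr_ge0.
    rewrite -[(rho ^+ 2)^-1]mul1r; apply: ler_pM => //.
    + by rewrite -expr2 sqr_ge0.
    + by rewrite invr_ge0 sqr_ge0.
    + rewrite -expr2 -real_normK ?num_real// exprn_ile1//; lra.
    + by rewrite lef_pV2 ?posrE ?exprn_gt0//; [rewrite ler_pXn2r ?nnegrE//; lra|lra].
  - by rewrite mul1r mulr_ge0// sqr_ge0.
  - by rewrite b2; field.
pose k := 1 - beta / 2.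
have k0 : k != 0 by apply/eqP; rewrite /k => h; move/eqP: nb2; lra.
pose e := Num.min (Num.min rho (1 / 2)) (rho * `|k| / beta).
have e0 : 0 < e by rewrite !lt_min r0 !divr_gt0// mulr_gt0// normr_gt0.
have er : e <= rho by rewrite !ge_min lexx.
have e2 : e <= 1 / 2 by rewrite !ge_min lexx orbT.
have ek : e <= rho * `|k| / beta by rewrite !ge_min lexx orbT.
clearbody e.
have [g [gg gk]] : exists g : R, g * g = 1 /\ g * k = `|k|.
  case: (ger0P k) => _; [exists 1|exists (-1)]; split; lra.
have ng : `|g| = 1.
  by apply/eqP; rewrite -(@eqrXn2 _ 2)// real_normK ?num_real// expr2 gg expr1n.
apply: (main g e (2 * beta)) => //; first by lra.
move=> p2 p3 h2 h3; have [d1 d2 d3] := bnd e p3 er h3 e0.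
have d0 : 2 * rho - p3 != 0 by rewrite gt_eqF//; lra.
exists (- 2 * beta * ((rho - p3) / (2 * rho - p3))).
exists (2 * (p2 * p2) * (k + beta / 2 * (p3 / (2 * rho - p3)))); split.
- rewrite normrM mulNr normrN (ger0_norm (x := 2 * beta)); last by lra.
  by rewrite ler_piMr//; lra.
- have -> : g * (2 * (p2 * p2) * (k + beta / 2 * (p3 / (2 * rho - p3)))) =
     2 * (p2 * p2) * (g * k + beta / 2 * (g * (p3 / (2 * rho - p3)))) by ring.
  apply: mulr_ge0; first by rewrite mulr_ge0// -expr2 sqr_ge0.
  have : `|g * (p3 / (2 * rho - p3))| <= `|k| / beta.
    rewrite normrM ng mul1r (le_trans d3)// ler_pdivrMr//.
    by move: ek; rewrite [rho * _]mulrC mulrAC.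
  rewrite ler_norml => /andP[h _].
  have : beta * - (`|k| / beta) <= beta * (g * (p3 / (2 * rho - p3))).
    by rewrite ler_wpM2l// ltW.
  rewrite mulrN mulrCA divff ?gt_eqF// mulr1 gk; have := normr_ge0 k; lra.
- by rewrite /k; field.
Qed.

(** Here [x2' + x2 = x1 (rho - x3)], so [2 (rho - x3) x1 x2] is the derivative of
[x2^2] plus [2 x2^2]; hence the choice of [2 rho x3 - x3^2 - x2^2], whose
derivative involves no [x1]. *)
Lemma not_STLC_f2_f3 (R : realType) (beta sigma rho : R) (f : 'cV[R]_3) (U : set R) :
  0 < beta -> 0 < rho -> bounded_set U -> f 1 0 = 0 -> f 2 0 = 0 ->
  ~ STLC (lorenz_drift beta sigma rho) f U 0.
Proof.
move=> b0 r0 bU f2 f3.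
have [g [e [C [gg e0 e2 C0 HC]]]] := circle_decay b0 r0.
have [T0 T00 HT] := small_time C0.
apply: (@not_STLC_lorenz _ _ _ _ e T0 _ _
  (fun q1 q2 q3 => 0 <= g * (2 * rho * q3 - q3 * q3 - q2 * q2)) bU _ _ T00) => //.
  move=> T x1 x2 x3 Tge TT0 [[ac1 ac2 ac3] [i1 i2 i3] bd dx].
  pose y t := g * (2 * rho * x3 t - x3 t * x3 t - x2 t * x2 t).
  have acy : ac_on T y.
    apply: acM => //; first exact: ac_cst.
    by apply: acB; first apply: acB; apply: acM => //; exact: ac_cst.
  apply: (@ac_barrier _ T _ y acy _ C0 (HT T Tge TT0)); last by rewrite Tge lexx.
    by rewrite /y i2 i3 !mulr0 !subr0 mulr0.
  apply: ae_imply dx => t H tT; have [u [d1 d2 d3]] := H tT.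
  move: tT; rewrite in_itv /= => /bd[b1 b2 b3].
  eexists; last exact: is_deriveM_fun (is_derive_cst g t 1) (is_deriveB_fun
    (is_deriveB_fun (is_deriveM_fun (is_derive_cst (2 * rho) t 1) d3)
       (is_deriveM_fun d3 d3)) (is_deriveM_fun d2 d2)).
  rewrite f2 f3 !mulr0 !addr0 /=.
  apply: le_trans (HC _ _ b2 b3) _; rewrite le_eqVlt; apply/orP; left.
  by apply/eqP; ring.
move=> d d0; pose h := Num.min (d / 2) rho.
have h0 : 0 < h by rewrite lt_min r0 divr_gt0.
have hd : h < d by rewrite gt_min; apply/orP; left; lra.
have hr : h <= rho by rewrite ge_min lexx orbT.
exists 0, 0, (- g * h).
have ng : `|g| = 1.
  by apply/eqP; rewrite -(@eqrXn2 _ 2)// real_normK ?num_real// expr2 gg expr1n.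
rewrite normr0 !normrM normrN ng (gtr0_norm h0) mul1r; split=> //=.
have -> : g * (2 * rho * (- g * h) - - g * h * (- g * h) - 0 * 0) =
   - ((g * g) * h * (2 * rho + g * h)) by ring.
rewrite gg mul1r; apply/negP; rewrite -ltNge oppr_lt0 mulr_gt0//.
have : `|g * h| <= rho by rewrite normrM ng mul1r (gtr0_norm h0).
by rewrite ler_norml => /andP[]; lra.
Qed.

Lemma not_STLC_f3 (R : realType) (beta sigma rho : R) (f : 'cV[R]_3) (U : set R) :
  bounded_set U -> f 0 0 != 0 -> f 1 0 != 0 -> f 2 0 = 0 ->
  ~ STLC (lorenz_drift beta sigma rho) f U 0.
Proof.
move=> bU f1 f2 f3.
pose L := `|sigma * f 1 0| + `|rho * f 0 0| + `|f 0 0|.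
have L0 : 0 <= L by rewrite !addr_ge0.
have [K K0 [T0 T00 H]] := quadratic_obstruction (- beta) f1 f2 (mul1r 1) L0.
pose k := f 0 0 * f 1 0.
have k0 : k != 0 by rewrite mulf_neq0.
apply: (@not_STLC_lorenz _ _ _ _ (1 / 2) T0 _ _
  (fun q1 q2 q3 => f 1 0 * q1 - f 0 0 * q2 = 0 -> 0 <= k * q3) bU _ _ T00);
  rewrite ?divr_gt0//.
  move=> T x1 x2 x3 Tge TT0 [[ac1 ac2 ac3] [i1 i2 i3] bd dx] w0.
  have := H T x1 x2 x3 Tge TT0 ac1 ac2 ac3 i1 i2 i3 _ _ T.
  rewrite w0 expr0n mulr0 addr0 mul1r Tge lexx; apply=> //.
    by move=> t /bd[b1 b2 _]; split; lra.
  apply: ae_imply dx => t Hd tT; have [u [d1 d2 d3]] := Hd tT.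
  move: tT; rewrite in_itv /= => /bd[b1 b2 b3].
  eexists; eexists; exists (- (sigma * f 1 0) - rho * f 0 0), (sigma * f 1 0 + f 0 0), (f 0 0 * x1 t).
  split; [exact: d1|exact: d2|by move: d3; rewrite f3 mulr0 addr0 mul1r|by ring|].
  have h1 := normr_ge0 (sigma * f 1 0); have h2 := normr_ge0 (rho * f 0 0).
  have h3 := normr_ge0 (f 0 0).
  split; rewrite /L.
  - have := ler_normB (- (sigma * f 1 0)) (rho * f 0 0); rewrite normrN; lra.
  - have := ler_normD (sigma * f 1 0) (f 0 0); lra.
  - have : `|f 0 0 * x1 t| <= `|f 0 0| by rewrite normrM ler_piMr//; lra.
    lra.
clearbody k; move=> d d0; exists 0, 0, (- k * (d / 2 / `|k|)).
have nk : 0 < `|k| by rewrite normr_gt0.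
rewrite normr0; split=> //.
  rewrite !normrM normrN !normfV. rewrite normr_id mulrC divfK ?gt_eqF//.
  by rewrite !ger0_norm//; lra.
rewrite !mulr0 subrr => /(_ erefl); apply/negP; rewrite -ltNge mulrA mulrN -expr2.
by rewrite mulNr oppr_lt0 mulr_gt0 ?exprn_even_gt0 ?divr_gt0.
Qed.

(** The function [x2 - m x1] is a left eigenvector of the linear part that
annihilates [f], and its derivative contains the quadratic term [- x1 x3]. *)
Lemma not_STLC_eigen (R : realType) (beta sigma rho m : R) (f : 'cV[R]_3) (U : set R) :
  bounded_set U -> f 0 0 != 0 -> f 2 0 != 0 -> f 1 0 = m * f 0 0 ->
  sigma * m ^+ 2 + (1 - sigma) * m = rho ->
  ~ STLC (lorenz_drift beta sigma rho) f U 0.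
Proof.
move=> bU f1 f3 f2 mE.
pose L := `|sigma * f 2 0| + `|sigma * m * f 2 0| + `|f 0 0| + `|beta * f 0 0|.
have L0 : 0 <= L by rewrite !addr_ge0.
have ss : (-1) * (-1) = 1 :> R by rewrite mulrNN mulr1.
have [K K0 [T0 T00 H]] := quadratic_obstruction (- (1 + m * sigma)) f1 f3 ss L0.
pose k := f 0 0 * f 2 0.
have k0 : k != 0 by rewrite mulf_neq0.
apply: (@not_STLC_lorenz _ _ _ _ (1 / 2) T0 _ _
  (fun q1 q2 q3 => f 2 0 * q1 - f 0 0 * q3 = 0 -> 0 <= - (k * (q2 - m * q1))) bU _ _ T00);
  rewrite ?divr_gt0//.
  move=> T x1 x2 x3 Tge TT0 [[ac1 ac2 ac3] [i1 i2 i3] bd dx] w0.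
  have acq : ac_on T (fun t => x2 t - m * x1 t).
    by apply: acB => //; apply: acM => //; exact: ac_cst.
  have := H T x1 x3 (fun t => x2 t - m * x1 t) Tge TT0 ac1 ac3 acq i1 i3 _ _ _ T.
  rewrite w0 expr0n mulr0 addr0 mulN1r !mulNr Tge lexx; apply=> //.
    by rewrite i1 i2 mulr0 subr0.
    by move=> t /bd[b1 b2 b3]; split; lra.
  apply: ae_imply dx => t Hd tT; have [u [d1 d2 d3]] := Hd tT.
  move: tT; rewrite in_itv /= => /bd[b1 b2 b3].
  eexists; eexists; exists (- (sigma * f 2 0) + sigma * m * f 2 0 - f 0 0 * x2 t), (beta * f 0 0), (sigma * f 2 0).
  split; [exact: d1|exact: d3| |by ring|].
    have := is_deriveB_fun d2 (is_deriveM_fun (is_derive_cst m t 1) d1).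
    rewrite f2 -mE; set D := (X in is_derive _ _ _ X -> _); set D' := (X in _ -> is_derive _ _ _ X).
    suff -> : D = D' by [].
    by rewrite /D /D' /=; ring.
  have h1 := normr_ge0 (sigma * f 2 0); have h2 := normr_ge0 (sigma * m * f 2 0).
  have h3 := normr_ge0 (f 0 0); have h4 := normr_ge0 (beta * f 0 0).
  have h5 : `|f 0 0 * x2 t| <= `|f 0 0| by rewrite normrM ler_piMr//; lra.
  split; rewrite /L; [|lra|lra].
  have := ler_normB (- (sigma * f 2 0) + sigma * m * f 2 0) (f 0 0 * x2 t).
  have := ler_normD (- (sigma * f 2 0)) (sigma * m * f 2 0); rewrite normrN; lra.
clearbody k; move=> d d0; exists 0, (k * (d / 2 / `|k|)), 0.
have nk : 0 < `|k| by rewrite normr_gt0.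
rewrite normr0; split=> //.
  rewrite !normrM !normfV normr_id mulrC divfK ?gt_eqF//.
  by rewrite !ger0_norm//; lra.
rewrite !mulr0 !subr0 => /(_ erefl); apply/negP; rewrite -ltNge mulrA -expr2.
by rewrite oppr_lt0 mulr_gt0 ?exprn_even_gt0 ?divr_gt0.
Qed.

Lemma mem_span2 (K : fieldType) (V : vectType K) (u v w : V) :
  w \in <<[:: u; v]>>%VS <-> exists a b, w = a *: u + b *: v.
Proof.
rewrite span_cons span_seq1; split.
  by move=> /memv_addP[_ /vlineP[a ->] [_ /vlineP[b ->] ->]]; exists a, b.
by move=> [a [b ->]]; apply: memv_add; apply: memvZ; exact: memv_line.
Qed.

(** Each plane is the zero set of a linear factor of the quadratic form, whose
discriminant is [d ^+ 2]. *)
Lemma lorenz_exceptionalE (R : realType) (sigma rho d : R) (f : 'cV[R]_3) :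
  0 < sigma -> 0 < rho -> d ^+ 2 = 4 * rho * sigma + (sigma - 1) ^+ 2 ->
  lorenz_exceptional sigma rho d f <->
  f 2 0 = 0 \/
  rho * f 0 0 ^+ 2 + (sigma - 1) * (f 0 0 * f 1 0) - sigma * f 1 0 ^+ 2 = 0.
Proof.
move=> s0 r0 dE.
have sn0 : sigma != 0 by rewrite gt_eqF.
have rn0 : rho != 0 by rewrite gt_eqF.
set Q := rho * _ + _ - _.
have spanv (e : R) :
    (f \in <<[:: e3 R; lorenz_v sigma e]>>%VS) <->
    2 * sigma * f 1 0 - (sigma - 1) * f 0 0 = e * f 0 0.
  rewrite mem_span2; split.
    move=> [a [b ->]]; rewrite !mxE /=; field; exact: sn0.
  move=> E; exists (f 2 0), (f 0 0).
  apply/matrixP => i j; rewrite ord1; apply: (ord3P (P := fun i => f i 0 = _)) i;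
    rewrite !mxE /=; [ring| |ring].
  have -> : f 1 0 = (e * f 0 0 + (sigma - 1) * f 0 0) / (2 * sigma).
    by rewrite -E; field.
  by field.
have spanw (e : R) : e ^+ 2 = d ^+ 2 ->
    f \in <<[:: e3 R; lorenz_w sigma rho e]>>%VS -> Q = 0.
  move=> eE /mem_span2[a [b fE]].
  have f0 : f 0 0 = b * ((1 - sigma + e) / (2 * rho)).
    by rewrite fE !mxE /=; ring.
  have f1 : f 1 0 = b by rewrite fE !mxE /=; ring.
  have : 4 * rho * Q = b ^+ 2 * (e ^+ 2 - (4 * rho * sigma + (sigma - 1) ^+ 2)).
    by rewrite /Q f0 f1; field.
  rewrite eE dE subrr mulr0 => /eqP; rewrite !mulf_eq0 (negPf rn0) pnatr_eq0 /=.
  by move/eqP.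
have QE : 4 * sigma * Q =
    (d * f 0 0) ^+ 2 - (2 * sigma * f 1 0 - (sigma - 1) * f 0 0) ^+ 2.
  by rewrite exprMn dE /Q; ring.
have NdE : (- d) ^+ 2 = d ^+ 2 by rewrite sqrrN.
have Q0 (e : R) : e ^+ 2 = d ^+ 2 ->
    2 * sigma * f 1 0 - (sigma - 1) * f 0 0 = e * f 0 0 -> Q = 0.
  move=> eE E; move: QE; rewrite E !exprMn eE subrr => /eqP.
  by rewrite !mulf_eq0 (negPf sn0) pnatr_eq0 /= => /eqP.
split.
  move=> [[[[|]|]|]|] /=.
  - by move=> /spanv H; right; exact: (Q0 d).
  - by move=> /spanv H; right; exact: (Q0 (- d)).
  - by move=> /spanw H; right; exact: H.
  - by move=> /spanw H; right; exact: H.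
  - move=> /(_ (e3 R) (memv_line _)) H; left; rewrite -H /dotv !big_ord_recl big_ord0 !mxE /=.
    have -> : lift ord0 (lift ord0 (ord0 : 'I_1)) = 2 :> 'I_3 by apply/val_inj.
    by ring.
move=> [f2|Qz].
  right => y /vlineP[k ->]; rewrite /dotv !big_ord_recl big_ord0 !mxE /=.
  have -> : lift ord0 (lift ord0 (ord0 : 'I_1)) = 2 :> 'I_3 by apply/val_inj.
  by rewrite f2; ring.
do 3 left; move: QE; rewrite Qz mulr0 => /esym/eqP; rewrite subr_eq0 eq_sym eqf_sqr.
move=> /orP[/eqP E|/eqP E]; [left|right]; apply/spanv.
  exact: E.
by rewrite E mulNr.
Qed.

Lemma STLC_not_exceptional (R : realType) (beta sigma rho d : R)
    (f : 'cV[R]_3) (U : set R) :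
  0 < beta -> 0 < sigma -> 0 < rho ->
  d ^+ 2 = 4 * rho * sigma + (sigma - 1) ^+ 2 -> bounded_set U ->
  STLC (lorenz_drift beta sigma rho) f U 0 ->
  ~ lorenz_exceptional sigma rho d f.
Proof.
move=> b0 s0 r0 dE bU stlc /(lorenz_exceptionalE f s0 r0 dE) exc.
apply: (_ : ~ STLC (lorenz_drift beta sigma rho) f U 0) stlc.
have [f3|f3] := eqVneq (f 2 0) 0.
  have [f1|f1] := eqVneq (f 0 0) 0; first exact: not_STLC_f1_f3.
  have [f2|f2] := eqVneq (f 1 0) 0; first exact: not_STLC_f2_f3.
  exact: not_STLC_f3.
case: exc => [E|Q0]; first by rewrite E eqxx in f3.
have [f1|f1] := eqVneq (f 0 0) 0.
  apply: not_STLC_e3 => //; apply/eqP; move/eqP: Q0.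
  by rewrite f1 expr0n mul0r !mulr0 addr0 sub0r oppr_eq0 mulf_eq0 gt_eqF//= sqrf_eq0.
apply: (@not_STLC_eigen _ _ _ _ (f 1 0 / f 0 0)) => //.
  by rewrite divfK.
apply/eqP; rewrite -subr_eq0 -oppr_eq0 -(mulIr_eq0 _ (mulIf (expf_neq0 2 f1))).
by rewrite -Q0; apply/eqP; field.
Qed.

(** * Fixed points and primitives *)

Lemma pow_half_small (R : realType) (B e : R) : 0 < e ->
  exists k : nat, B / 2 ^+ k < e.
Proof.
move=> e0; have : (fun k => B / 2 ^+ k) @ \oo --> (0 : R).
  rewrite -(mulr0 B); apply: cvgM; first exact: cvg_cst.
  under eq_fun do rewrite -exprVn.
  by apply: cvg_expr; rewrite ger0_norm ?invr_ge0// invf_lt1// ltr1n.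
move=> /cvgrPdist_lt/(_ e e0)[k _ Hk]; exists k.
have := Hk k (leqnn k); rewrite /= sub0r normrN; exact/le_lt_trans/ler_norm.
Qed.

(** Banach's theorem for the sup norm, on a set of functions closed under
pointwise limits. All iterates lie in a bounded set, so [G^k] brings any two of
them within [2 B / 2^k]. *)
Lemma pointwise_contraction (R : realType) (I : Type)
    (V : completeNormedModType R) (S : set (I -> V)) (G : (I -> V) -> I -> V)
    (x0 : I -> V) (B : R) :
  S x0 -> (forall x, S x -> S (G x)) ->
  (forall x i, S x -> `|x i| <= B) ->
  (forall (u : nat -> I -> V) x, (forall k, S (u k)) ->
     (forall i, u ^~ i @ \oo --> x i) -> S x) ->
  (forall x y D, S x -> S y -> (forall i, `|x i - y i| <= D) ->
     forall i, `|G x i - G y i| <= D / 2) ->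
  exists2 x, S x & forall i, G x i = x i.
Proof.
move=> S0 SG SB Scl Gc.
pose u k := iter k G x0.
have Su k : S (u k) by elim: k => //= k IH; exact: SG.
have ukm k m i : `|u (m + k)%N i - u k i| <= (2 * B) / 2 ^+ k.
  elim: k m i => [|k IH] m i.
    rewrite expr0 divr1; apply: le_trans (ler_normB _ _) _.
    have := SB (u (m + 0)%N) i (Su _); have := SB (u 0%N) i (Su _); lra.
  rewrite addnS exprS invfM mulrA mulrAC.
  exact: (Gc _ _ _ (Su (m + k)%N) (Su k) (IH m)).
have cv i : cvgn (u ^~ i).
  apply/cauchy_cvgP/cauchy_exP => e e0.
  have [k Hk] := pow_half_small (2 * B) e0.
  exists (u k i), k => // m /= km.
  rewrite -ball_normE /= distrC -(subnK km).
  exact: le_lt_trans (ukm k _ i) Hk.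
pose x i := limn (u ^~ i).
have Sx : S x by apply: Scl Su _ => i; exact: cv.
have xu k i : `|x i - u k i| <= (2 * B) / 2 ^+ k.
  have : (fun m => `|u m i - u k i|) @ \oo --> `|x i - u k i|.
    by apply: cvg_norm; apply: cvgB; [exact: cv|exact: cvg_cst].
  move=> /cvgrPdist_le H; apply/ler_addgt0Pr => e e0.
  have [N _ HN] := H e e0.
  have := HN (maxn N k) (leq_maxl _ _); rewrite /= ler_norml => /andP[_].
  have := ukm k (maxn N k - k)%N i; rewrite subnK ?leq_maxr//; lra.
exists x => // i; apply/eqP; rewrite -subr_eq0 -normr_le0.
apply/ler_addgt0Pr => e e0; rewrite add0r.
have [k Hk] := pow_half_small (2 * B) (e := e / 2) ltac:(lra).
have h1 : `|G x i - u k.+1 i| <= (2 * B) / 2 ^+ k / 2 by apply: Gc => //; exact: xu.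
have h2 := xu k.+1 i.
have -> : G x i - x i = (G x i - u k.+1 i) - (x i - u k.+1 i).
  by rewrite opprB addrA subrK.
apply: le_trans (ler_normB _ _) _.
rewrite exprS invfM mulrA mulrAC in h2; lra.
Qed.

Lemma deriv_bound (R : realType) (W : normedModType R) (x : R -> W) (M a b : R) :
  a <= b ->
  (forall t, a <= t <= b -> exists2 D, `|D| <= M & is_derive t (1 : R) x D) ->
  `|x b - x a| <= M * (b - a).
Proof.
move=> ab dx.
suff key e : 0 < e -> `|x b - x a| <= (M + e) * (b - a).
  apply/ler_addgt0Pr => e e0.
  have p0 : 0 < b - a + 1 by lra.
  apply: le_trans (key (e / (b - a + 1)) (divr_gt0 e0 p0)) _.
  rewrite mulrDl lerD2l mulrAC -mulrA ler_piMr ?ltW// ltr_pdivrMr//; lra.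
move=> e0.
apply: (@gauge_induction _ (fun l r => `|x r - x l| <= (M + e) * (r - l))) => //.
  move=> l m r _ _ _ _ h1 h2.
  have -> : x r - x l = (x r - x m) + (x m - x l) by rewrite addrA subrK.
  apply: le_trans (ler_normD _ _) _; lra.
move=> t tab; have [D DM /is_deriveE dD] := dx t tab.
have [d d0 Hd] := dD e e0; exists d => // l r al lt_ tr rb dl dr.
have step s : `|s - t| < d -> `|x s - x t| <= (M + e) * `|s - t|.
  move=> /Hd H; rewrite -[x s - x t](subrK ((s - t) *: D)).
  apply: le_trans (ler_normD _ _) _; rewrite mulrDl addrC.
  by apply: lerD => //; rewrite normrZ mulrC ler_wpM2r.
have h1 : `|x l - x t| <= (M + e) * (t - l).
  have := step l; rewrite ler0_norm ?subr_le0// opprB; apply; lra.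
have h2 : `|x r - x t| <= (M + e) * (r - t).
  have := step r; rewrite ger0_norm ?subr_ge0//; apply; lra.
have -> : x r - x l = (x r - x t) - (x l - x t) by rewrite opprB addrA subrK.
apply: le_trans (ler_normB _ _) _; lra.
Qed.

(** The integral starts at [-1] so that 0 is an interior point, where the
two-sided derivative exists. *)
Lemma exists_primitive (R : realType) (g : R -> R) : continuous g ->
  exists P : R -> R, P 0 = 0 /\ forall t : R, 0 <= t -> is_derive t (1 : R) P (g t).
Proof.
move=> cg.
pose P0 x := (\int[@lebesgue_measure R]_(t in [set` `[-1, x]]) (g t))%R.
exists (fun t => P0 t - P0 0); split; first by rewrite subrr.
move=> t t0.
have tt1 : t < t + 1 by rewrite ltrDl.
have t1 : -1 < t by lra.
have gi : (@lebesgue_measure R).-integrable `[-1, t + 1] (EFin \o g).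
  apply: continuous_compact_integrable; first exact: segment_compact.
  exact: continuous_subspaceT.
have [d1 d2] := continuous_FTC1_closed tt1 gi t1 (cg t).
have dP : is_derive t (1 : R) P0 (g t).
  by apply: DeriveDef; [exact: d1|rewrite -d2 derive1E].
rewrite -[g t]subr0; apply: is_deriveB.
Qed.

Lemma exists_primitive_cV (R : realType) (n : nat) (g : R -> 'cV[R]_n.+1) (L : R) :
  (forall s t, `|g s - g t| <= L * `|s - t|) ->
  exists P : R -> 'cV[R]_n.+1,
    P 0 = 0 /\ forall t : R, 0 <= t -> is_derive t (1 : R) P (g t).
Proof.
move=> gL.
have cg i : continuous (fun t => g t i 0).
  move=> t; apply/cvgrPdist_lt => e e0.
  have L0 : 0 < `|L| + 1 by rewrite ltr_wpDl.
  exists (e / (`|L| + 1)); first exact: divr_gt0.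
  move=> s /=; rewrite ltr_pdivlMr// mulrC => st; apply: le_lt_trans st.
  apply: (@le_trans _ _ (L * `|t - s|)).
    apply: le_trans (gL t s); apply: le_trans (cV_norm_coord _ i).
    by rewrite !mxE.
  by rewrite ler_wpM2r// (le_trans (ler_norm L))// lerDl.
have /choice[P HP] : forall i, exists P : R -> R, P 0 = 0 /\
    forall t : R, 0 <= t -> is_derive t (1 : R) P (g t i 0).
  by move=> i; exact: exists_primitive.
exists (fun t => \col_i P i t); split.
  by apply/matrixP => i j; rewrite !mxE; case: (HP i).
move=> t t0; apply/is_derive_coord => i.
rewrite (_ : (fun s => _) = P i); first by case: (HP i) => _; apply.
by apply/funext => s; rewrite !mxE.
Qed.

(** * Sawtooth primitives of two-valued controls *)

Definition slopes_between (R : realType) (a b T : R) (W : R -> R) : Prop :=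
  forall s t, 0 <= s -> s <= t -> t <= T -> a * (t - s) <= W t - W s <= b * (t - s).

(** On the cell [[k h, (k + 1) h]]: leave the graph of [W] at the left node with
slope [b], and reach it again at the right node with slope [a]. *)
Definition tooth (R : realType) (a b h : R) (W : R -> R) (k : nat) (t : R) : R :=
  Num.min (W (k%:R * h) + b * (t - k%:R * h))
          (W (k.+1%:R * h) + a * (t - k.+1%:R * h)).

(** Outside its cell a tooth lies below [W], so the maximum of all teeth selects
the right one ([sawtoothE]); unlike a definition by cases, the maximum is
visibly Lipschitz. *)
Fixpoint sawtooth (R : realType) (a b h : R) (W : R -> R) (m : nat) (t : R) : R :=
  if m is m'.+1 then Num.max (sawtooth a b h W m' t) (tooth a b h W m t)
  else tooth a b h W 0 t.

Lemma min_lip (R : realType) (p q p' q' D : R) : `|p - p'| <= D -> `|q - q'| <= D ->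
  `|Num.min p q - Num.min p' q'| <= D.
Proof.
by rewrite !ler_norml => /andP[? ?] /andP[? ?]; case: (leP p q); case: (leP p' q'); lra.
Qed.

Lemma max_lip (R : realType) (p q p' q' D : R) : `|p - p'| <= D -> `|q - q'| <= D ->
  `|Num.max p q - Num.max p' q'| <= D.
Proof.
by rewrite !ler_norml => /andP[? ?] /andP[? ?]; case: (leP p q); case: (leP p' q'); lra.
Qed.

Lemma sawtooth_lip (R : realType) (a b h : R) (W : R -> R) m s t :
  `|sawtooth a b h W m s - sawtooth a b h W m t| <= (`|a| + `|b|) * `|s - t|.
Proof.
have T k : `|tooth a b h W k s - tooth a b h W k t| <= (`|a| + `|b|) * `|s - t|.
  apply: min_lip.
    have -> : W (k%:R * h) + b * (s - k%:R * h) - (W (k%:R * h) + b * (t - k%:R * h)) =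
       b * (s - t) by ring.
    by rewrite normrM ler_wpM2r// lerDr.
  have -> : W (k.+1%:R * h) + a * (s - k.+1%:R * h) -
      (W (k.+1%:R * h) + a * (t - k.+1%:R * h)) = a * (s - t) by ring.
  by rewrite normrM ler_wpM2r// lerDl.
by elim: m => [|m IH] /=; [exact: T|exact: max_lip].
Qed.

Lemma grid_cell (R : realType) (h : R) (m : nat) (t : R) :
  0 <= t -> t <= m.+1%:R * h ->
  exists2 k : nat, (k <= m)%N & k%:R * h <= t <= k.+1%:R * h.
Proof.
move=> t0; elim: m => [|m IH] tm; first by exists 0%N => //; rewrite mul0r t0.
have [/IH[k km kt]|mt] := leP t (m.+1%:R * h); first by exists k => //; exact: leqW.
by exists m.+1 => //; rewrite tm (ltW mt).
Qed.

Lemma grid_le (R : realType) (h : R) (j k : nat) : 0 < h -> (j <= k)%N ->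
  j%:R * h <= k%:R * h.
Proof. by move=> h0 jk; rewrite ler_wpM2r ?ler_nat ?(ltW h0). Qed.

Lemma tooth_ge (R : realType) (a b h T : R) (W : R -> R) (k : nat) (t : R) :
  0 < h -> slopes_between a b T W -> k.+1%:R * h <= T ->
  k%:R * h <= t <= k.+1%:R * h ->
  W t <= tooth a b h W k t <= W t + (b - a) * h.
Proof.
move=> h0 Wab kT /andP[kt tk].
have k0 : 0 <= k%:R * h by rewrite mulr_ge0// (ltW h0).
have /andP[h1 h2] := Wab _ _ k0 kt (le_trans tk kT).
have /andP[h3 h4] := Wab _ _ (le_trans k0 kt) tk kT.
have kk : k.+1%:R * h - k%:R * h = h by rewrite -natr1; ring.
rewrite /tooth le_min ge_min; apply/andP; split; first by apply/andP; split; lra.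
have h0t : h - (t - k%:R * h) >= 0 by lra.
have ab : (b - a) * (t - k%:R * h) <= (b - a) * h.
  apply: ler_wpM2l; last by lra.
  have /andP[u v] := Wab _ _ k0 (grid_le h0 (leqnSn k)) kT.
  rewrite kk in u v; rewrite -(pmulr_lge0 _ h0); lra.
apply/orP; left; lra.
Qed.

Lemma tooth_le (R : realType) (a b h T : R) (W : R -> R) (k : nat) (t : R) :
  0 < h -> slopes_between a b T W -> k.+1%:R * h <= T -> 0 <= t -> t <= T ->
  t <= k%:R * h \/ k.+1%:R * h <= t -> tooth a b h W k t <= W t.
Proof.
move=> h0 Wab kT t0 tT [tk|kt]; rewrite /tooth ge_min; apply/orP; [left|right].
  have := Wab _ _ t0 tk (le_trans (grid_le h0 (leqnSn k)) kT).
  by move=> /andP[h1 h2]; lra.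
have k0 : 0 <= k.+1%:R * h by rewrite mulr_ge0// (ltW h0).
have := Wab _ _ k0 kt tT.
by move=> /andP[h1 h2]; lra.
Qed.

Lemma sawtoothE (R : realType) (a b h : R) (W : R -> R) (m k : nat) (t : R) :
  0 < h -> slopes_between a b (m.+1%:R * h) W -> (k <= m)%N ->
  k%:R * h <= t <= k.+1%:R * h ->
  sawtooth a b h W m t = tooth a b h W k t.
Proof.
move=> h0 Wab km kt; have /andP[kt1 kt2] := kt.
set T := m.+1%:R * h in Wab.
have kT : k.+1%:R * h <= T by exact: grid_le.
have t0 : 0 <= t by apply: le_trans kt1; rewrite mulr_ge0// (ltW h0).
have tT : t <= T by exact: le_trans kT.
have /andP[Wt _] := tooth_ge h0 Wab kT kt.
have other j : (j <= m)%N -> j != k -> tooth a b h W j t <= tooth a b h W k t.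
  move=> jm jk; apply: le_trans Wt; apply: (tooth_le h0 Wab) => //.
    exact: grid_le.
  case: (ltngtP j k) jk => // jk _; [right|left].
    by apply: le_trans kt1; exact: grid_le.
  by apply: le_trans kt2 _; exact: grid_le.
suff H i : (i <= m)%N -> if (k <= i)%N then sawtooth a b h W i t = tooth a b h W k t
     else sawtooth a b h W i t <= tooth a b h W k t.
  by have := H m (leqnn m); rewrite km.
elim: i => [|i IH] im /=.
  case: k {kT kt1 kt2 kt Wt km} other => [//|k] other /=; exact: other.
have {}IH := IH (ltnW im).
case: (ltngtP k i.+1) => [ki|ik|ki].
- rewrite ltnS in ki; rewrite ki in IH; rewrite IH.
  by apply/max_idPl; rewrite other// gtn_eqF// ltnS.
- rewrite leqNgt (ltnW ik) /= in IH.
  by rewrite ge_max IH other// ltn_eqF.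
- by rewrite {}ki ltnn in IH *; exact/max_idPr.
Qed.

Lemma sawtooth_near (R : realType) (a b h : R) (W : R -> R) (m : nat) (t : R) :
  0 < h -> slopes_between a b (m.+1%:R * h) W -> 0 <= t <= m.+1%:R * h ->
  W t <= sawtooth a b h W m t <= W t + (b - a) * h.
Proof.
move=> h0 Wab /andP[t0 tT]; have [k km kt] := grid_cell t0 tT.
rewrite (sawtoothE h0 Wab km kt); apply: (tooth_ge h0 Wab _ kt).
exact: grid_le.
Qed.

(** On a cell the sawtooth only involves the values of [W] at the two nodes, and
the increment of [W - W'] between [t] and a node is at most [D h]. *)
Lemma sawtooth_param_lip (R : realType) (a b h D : R) (W W' : R -> R) (m : nat) (t : R) :
  0 < h -> slopes_between a b (m.+1%:R * h) W ->
  slopes_between a b (m.+1%:R * h) W' ->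
  (forall r s, 0 <= r <= m.+1%:R * h -> 0 <= s <= m.+1%:R * h ->
     `|(W r - W' r) - (W s - W' s)| <= D * `|r - s|) ->
  0 <= t <= m.+1%:R * h ->
  `|(sawtooth a b h W m t - W t) - (sawtooth a b h W' m t - W' t)| <= D * h.
Proof.
move=> h0 Wab Wab' WD tT; have /andP[t0 tT'] := tT.
have [k km kt] := grid_cell t0 tT'; have /andP[kt1 kt2] := kt.
rewrite !(sawtoothE h0 _ km kt)//.
have kk : k.+1%:R * h - k%:R * h = h by rewrite -natr1; ring.
have h1h : 0 <= h <= m.+1%:R * h.
  by rewrite ltW//= ler_peMl ?ler1n ?(ltW h0)//.
have D0 : 0 <= D.
  have := WD h 0 h1h; rewrite lexx mulr_ge0 ?(ltW h0)// => /(_ isT).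
  by rewrite subr0 (gtr0_norm h0) => /(le_trans (normr_ge0 _)); rewrite pmulr_lge0.
have dist s : 0 <= s <= m.+1%:R * h -> `|s - t| <= h ->
    `|(W s - W t) - (W' s - W' t)| <= D * h.
  move=> sT st; have -> : (W s - W t) - (W' s - W' t) = (W s - W' s) - (W t - W' t) by ring.
  by apply: le_trans (WD s t sT tT) _; rewrite ler_wpM2l.
have E p q w p' q' w' : `|(p - w) - (p' - w')| <= D * h ->
    `|(q - w) - (q' - w')| <= D * h ->
    `|(Num.min p q - w) - (Num.min p' q' - w')| <= D * h.
  have mB (x y z : R) : Num.min x y - z = Num.min (x - z) (y - z).
    by rewrite addr_minl.
  by move=> h1 h2; rewrite (mB p q w) (mB p' q' w'); exact: min_lip.
have k0 : 0 <= k%:R * h by rewrite mulr_ge0// (ltW h0).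
apply: E.
  have := dist (k%:R * h); rewrite k0 ler0_norm; last by lra.
  have -> : W (k%:R * h) + b * (t - k%:R * h) - W t -
    (W' (k%:R * h) + b * (t - k%:R * h) - W' t) =
    (W (k%:R * h) - W t) - (W' (k%:R * h) - W' t) by ring.
  by apply; [exact: le_trans tT'|lra].
have := dist (k.+1%:R * h); rewrite ger0_norm; last by lra.
have -> : W (k.+1%:R * h) + a * (t - k.+1%:R * h) - W t -
    (W' (k.+1%:R * h) + a * (t - k.+1%:R * h) - W' t) =
    (W (k.+1%:R * h) - W t) - (W' (k.+1%:R * h) - W' t) by ring.
apply; last by lra.
by rewrite mulr_ge0 ?(ltW h0)//= grid_le.
Qed.

Lemma sawtooth_ends (R : realType) (a b h : R) (W : R -> R) (m : nat) :
  0 < h -> slopes_between a b (m.+1%:R * h) W ->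
  sawtooth a b h W m 0 = W 0 /\
  sawtooth a b h W m (m.+1%:R * h) = W (m.+1%:R * h).
Proof.
move=> h0 Wab.
have hT : h <= m.+1%:R * h by rewrite ler_peMl ?ler1n ?(ltW h0)//.
split.
  rewrite (sawtoothE (k := 0) h0 Wab)//; last by rewrite mul0r lexx mulr_ge0// (ltW h0).
  rewrite /tooth mul0r mul1r subrr mulr0 addr0; apply/min_idPl.
  have /andP[h1 h2] := Wab 0 h (lexx _) (ltW h0) hT; lra.
rewrite (sawtoothE (k := m) h0 Wab)//; last by rewrite grid_le//= lexx.
rewrite /tooth subrr mulr0 addr0; apply/min_idPr.
have m0 : 0 <= m%:R * h by rewrite mulr_ge0// (ltW h0).
have /andP[h1 h2] := Wab _ _ m0 (grid_le h0 (leqnSn m)) (lexx _); lra.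
Qed.

(** The slope is [b] on [[k h, c k[] and [a] on [[c k, (k + 1) h[], where [c k] is the
abscissa at which the two lines of the tooth meet. *)
Lemma sawtooth_control (R : realType) (a b h : R) (W : R -> R) (m : nat) :
  a < b -> 0 < h -> slopes_between a b (m.+1%:R * h) W ->
  exists u : R -> R, [/\ forall t, u t = a \/ u t = b,
    measurable_fun setT u &
    {ae (@lebesgue_measure R), forall t, t \in `[0, m.+1%:R * h] ->
       0 < t < m.+1%:R * h /\
       is_derive t (1 : R) (sawtooth a b h W m) (u t)}].
Proof.
move=> ab h0 Wab; set T := m.+1%:R * h in Wab *.
have ba : 0 < b - a by lra.
pose c k : R := k%:R * h + (W (k.+1%:R * h) - W (k%:R * h) - a * h) / (b - a).
have kk k : k.+1%:R * h = k%:R * h + h by rewrite -natr1; ring.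
have kT k : (k <= m)%N -> k.+1%:R * h <= T by move=> km; rewrite /T; exact: grid_le.
have ck k : (k <= m)%N -> c k <= k.+1%:R * h.
  move=> km; have k0 : 0 <= k%:R * h by rewrite mulr_ge0// (ltW h0).
  have /andP[_ h2] := Wab _ _ k0 (grid_le h0 (leqnSn k)) (kT k km).
  rewrite /c kk lerD2l ler_pdivrMr//; rewrite kk in h2; lra.
pose P := \bigcup_(k in [set k : nat | (k <= m)%N]) `[k%:R * h, c k[%classic.
have mP : measurable P by apply: bigcup_measurable => k _; exact: measurable_itv.
pose u t := a + (b - a) * (\1_P t).
exists u; split.
- move=> t; rewrite /u indicE; case: (t \in P); rewrite ?mulr1 ?mulr0; [right|left]; ring.
- apply: measurable_funD => //; apply: measurable_funM => //.
pose N := \bigcup_(k in [set: nat]) [set k%:R * h; c k].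
have cN : countable N.
  apply: bigcup_countable => [|k _]; first exact: countableP.
  exact/finite_set_countable/finite_set2.
exists N; split.
  by apply: countable_measurable.
  exact: countable_lebesgue_measure0.
move=> t /= nt; apply: contrapT => nN; apply: nt; rewrite in_itv /= => /andP[t0 tT].
have nk k : t != k%:R * h by apply/eqP => E; apply: nN; exists k => //=; left.
have nc k : t != c k by apply/eqP => E; apply: nN; exists k => //=; right.
split.
  have := nk 0%N; have := nk m.+1; rewrite mul0r => h1 h2.
  by apply/andP; split; rewrite lt_neqAle ?t0 ?tT andbT // eq_sym.
have [k km kt] := grid_cell t0 tT; have /andP[kt1 kt2] := kt.
have kt1' : k%:R * h < t by rewrite lt_neqAle eq_sym nk.
have kt2' : t < k.+1%:R * h by rewrite lt_neqAle nk.
have LE s : (W (k.+1%:R * h) + a * (s - k.+1%:R * h)) -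
    (W (k%:R * h) + b * (s - k%:R * h)) = (b - a) * (c k - s).
  rewrite /c kk; field; lra.
have lin (sl l r w0 : R) : l < t -> t < r ->
   (forall s, l < s -> s < r -> sawtooth a b h W m s = w0 + sl * s) ->
   is_derive t (1 : R) (sawtooth a b h W m) sl.
  move=> lt_ tr E; apply/is_deriveE => e e0; exists (Num.min (t - l) (r - t)).
    by rewrite lt_min; lra.
  move=> s; rewrite lt_min ltr_norml ltr_norml => /andP[/andP[s1 s2] /andP[s3 s4]].
  rewrite !E//; try lra.
  have -> : w0 + sl * s - (w0 + sl * t) - (s - t) *: sl = 0.
    by rewrite /GRing.scale /=; ring.
  by rewrite normr0 mulr_ge0// ltW.
have [tc|ct|tc] := ltgtP t (c k); last by move: (nc k); rewrite tc eqxx.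
  have -> : u t = b.
    rewrite /u indicE mem_set ?mulr1; first by ring.
    exists k => //=; by rewrite in_itv /= kt1.
  apply: (lin b (k%:R * h) (c k) (W (k%:R * h) - b * (k%:R * h))) => // s s1 s2.
  rewrite (sawtoothE h0 Wab km); last by rewrite ltW//= (le_trans (ltW s2))// ck.
  rewrite /tooth; have -> : Num.min (W (k%:R * h) + b * (s - k%:R * h))
     (W (k.+1%:R * h) + a * (s - k.+1%:R * h)) = W (k%:R * h) + b * (s - k%:R * h).
    apply/min_idPl; rewrite -subr_ge0 LE mulr_ge0//; lra.
  by ring.
have -> : u t = a.
  rewrite /u indicE memNset ?mulr0 ?addr0//.
  move=> [j /= jm]; rewrite in_itv /= => /andP[j1 j2].
  case: (ltngtP j k) => [jk|kj|jk]; last by rewrite jk in j2; lra.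
    have := ck j (leq_trans (ltnW jk) km).
    have := grid_le h0 jk; lra.
  have := grid_le h0 kj; lra.
apply: (lin a (c k) (k.+1%:R * h) (W (k.+1%:R * h) - a * (k.+1%:R * h))) => // s s1 s2.
have kc : k%:R * h <= c k.
  have k0 : 0 <= k%:R * h by rewrite mulr_ge0// (ltW h0).
  have /andP[h1 _] := Wab _ _ k0 (grid_le h0 (leqnSn k)) (kT k km).
  rewrite /c lerDl divr_ge0 ?(ltW ba)//; rewrite kk in h1 *; lra.
rewrite (sawtoothE h0 Wab km); last by rewrite (ltW s2) andbT (le_trans kc (ltW s1)).
rewrite /tooth; have -> : Num.min (W (k%:R * h) + b * (s - k%:R * h))
   (W (k.+1%:R * h) + a * (s - k.+1%:R * h)) = W (k.+1%:R * h) + a * (s - k.+1%:R * h).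
  apply/min_idPr; rewrite -subr_le0 LE pmulr_rle0//; lra.
by ring.
Qed.

(** * The linear test with two-valued controls *)

(* Join of the normed and of the complete structure on matrices. *)
HB.instance Definition _ (R : realType) (m n : nat) := Complete.on (matrix R m n).

Lemma mulmx_bounded (R : realType) (n : nat) (A : 'M[R]_n.+1) :
  exists2 K : R, 0 < K & forall z : 'cV[R]_n.+1, `|A *m z| <= K * `|z|.
Proof.
exists (\sum_i \sum_j `|A i j| + 1).
  by rewrite ltr_wpDl// sumr_ge0// => i _; exact: sumr_ge0.
move=> z; apply: cV_norm_le => i; rewrite mxE.
apply: le_trans (ler_norm_sum _ _ _) _.
apply: (@le_trans _ _ ((\sum_j `|A i j|) * `|z|)).
  rewrite mulr_suml; apply: ler_sum => j _; rewrite normrM.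
  by rewrite ler_wpM2l// cV_norm_coord.
rewrite ler_wpM2r// [X in _ <= X + 1](bigD1 i)//= -addrA lerDl addr_ge0//.
by rewrite sumr_ge0// => k _; exact: sumr_ge0.
Qed.

Definition clamp (R : realType) (T t : R) : R := Num.max 0 (Num.min t T).

Lemma clamp_itv (R : realType) (T t : R) : 0 <= T -> 0 <= clamp T t <= T.
Proof. by move=> T0; rewrite /clamp le_max lexx /= ge_max T0 ge_min lexx orbT. Qed.

Lemma clamp_id (R : realType) (T t : R) : 0 <= t <= T -> clamp T t = t.
Proof. by move=> /andP[t0 tT]; rewrite /clamp (min_idPl tT) (max_idPr t0). Qed.

Lemma clamp_lip (R : realType) (T s t : R) : `|clamp T s - clamp T t| <= `|s - t|.
Proof.
apply: max_lip; first by rewrite subrr normr0.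
by apply: min_lip => //; rewrite subrr normr0.
Qed.

(** The operator sends [eta] to the primitive of
[A (eta + e p) + N (X p + e p + eta)], with [p = q - eta T]. [p] and
[e p] depend on [eta] with Lipschitz constant 1, so that after integration the
first term contributes [2 T K] and the second [T eps (C + 2)]. Time is clamped to [[0, T]]
so that every function lives on the whole line. *)
Lemma forced_fixed_point (R : realType) (n : nat) (A : 'M[R]_n.+1)
    (N : 'cV[R]_n.+1 -> 'cV[R]_n.+1) (X e : 'cV[R]_n.+1 -> R -> 'cV[R]_n.+1)
    (K T rho r eps C L : R) (q : 'cV[R]_n.+1) :
  0 < T -> 0 < rho -> 0 <= eps -> 0 <= C -> 0 <= L -> 0 <= K ->
  (forall z : 'cV[R]_n.+1, `|A *m z| <= K * `|z|) ->
  N 0 = 0 ->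
  (forall z z', `|z| <= r -> `|z'| <= r -> `|N z - N z'| <= eps * `|z - z'|) ->
  T * K <= 1 / 8 -> T * (eps * (C + 2)) <= 1 / 8 -> (C + 1) * rho <= r ->
  (forall p t, 0 <= t <= T -> `|p| <= rho -> `|X p t| <= C * `|p|) ->
  (forall p p' t, 0 <= t <= T -> `|p| <= rho -> `|p'| <= rho ->
     `|X p t - X p' t| <= C * `|p - p'|) ->
  (forall p s t, 0 <= s <= T -> 0 <= t <= T -> `|p| <= rho ->
     `|X p s - X p t| <= L * `|s - t|) ->
  (forall p t, 0 <= t <= T -> `|p| <= rho -> `|e p t| <= rho / 8) ->
  (forall p p' t, 0 <= t <= T -> `|p| <= rho -> `|p'| <= rho ->
     `|e p t - e p' t| <= `|p - p'|) ->
  (forall p s t, 0 <= s <= T -> 0 <= t <= T -> `|p| <= rho ->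
     `|e p s - e p t| <= L * `|s - t|) ->
  `|q| <= rho / 2 ->
  exists (eta : R -> 'cV[R]_n.+1) (M : R),
    let p := q - eta T in
    [/\ `|p| <= rho, eta 0 = 0, forall s t, `|eta s - eta t| <= M * `|s - t| &
        forall t, 0 < t < T -> is_derive t (1 : R) eta
          (A *m (eta t + e p t) + N (X p t + e p t + eta t))].
Proof.
move=> T0 r0 eps0 C0 L0 K0 AK N0 Nlip TK TE Cr XC XD XL eb eD eL qr.
have T0' := ltW T0.
(* [M] bounds the integrand; since [T M = rho / 2], it is both what keeps the
   image in the ball and a common Lipschitz constant. *)
pose M := rho / (2 * T).
have M0 : 0 <= M by rewrite divr_ge0 ?mulr_ge0// ltW.
pose S : set (R -> 'cV[R]_n.+1) := [set eta | (forall t, `|eta t| <= rho / 2) /\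
   (forall s t, `|eta s - eta t| <= M * `|s - t|)].
pose p (eta : R -> 'cV[R]_n.+1) := q - eta T.
pose z eta s := X (p eta) s + e (p eta) s + eta s.
pose g eta s := A *m (eta s + e (p eta) s) + N (z eta s).
have Sp eta : S eta -> `|p eta| <= rho.
  move=> [h _]; apply: le_trans (ler_normB _ _) _.
  by have := h T; lra.
have Sz eta s : S eta -> 0 <= s <= T -> `|z eta s| <= (C + 1) * rho.
  move=> Se sT; have pr := Sp eta Se; case: (Se) => h _.
  apply: le_trans (ler_normD _ _) _; have := ler_normD (X (p eta) s) (e (p eta) s).
  have := XC _ s sT pr; have := eb _ s sT pr; have := h s.
  have : C * `|p eta| <= C * rho by rewrite ler_wpM2l.
  lra.
have Szr eta s : S eta -> 0 <= s <= T -> `|z eta s| <= r.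
  by move=> Se sT; apply: le_trans Cr; exact: Sz.
have rr0 : `|0 : 'cV[R]_n.+1| <= r.
  by rewrite normr0; apply: le_trans Cr; rewrite mulr_ge0// ?addr_ge0// ltW.
have gM eta s : S eta -> 0 <= s <= T -> `|g eta s| <= M.
  move=> Se sT; have pr := Sp eta Se; case: (Se) => h _.
  apply: le_trans (ler_normD _ _) _.
  have h1 : `|A *m (eta s + e (p eta) s)| <= K * rho.
    apply: le_trans (AK _) _; rewrite ler_wpM2l//.
    apply: le_trans (ler_normD _ _) _; have := h s; have := eb _ s sT pr; lra.
  have h2 : `|N (z eta s)| <= eps * ((C + 2) * rho).
    have := Nlip (z eta s) 0 (Szr _ _ Se sT) rr0; rewrite N0 !subr0 => /le_trans; apply.
    rewrite ler_wpM2l//; apply: le_trans (Sz _ _ Se sT) _; rewrite ler_wpM2r ?(ltW r0)//.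
    lra.
  rewrite -(ler_pM2l T0) mulrDr /M.
  have -> : T * (rho / (2 * T)) = rho / 2 by field; rewrite gt_eqF.
  have h3 : T * `|A *m (eta s + e (p eta) s)| <= T * (K * rho) by rewrite ler_pM2l.
  have h4 : T * `|N (z eta s)| <= T * (eps * ((C + 2) * rho)) by rewrite ler_pM2l.
  have h5 : T * K * rho <= 1 / 8 * rho by rewrite ler_pM2r.
  have h6 : T * (eps * (C + 2)) * rho <= 1 / 8 * rho by rewrite ler_pM2r.
  lra.
pose Lg := K * (M + L) + eps * (L + L + M).
have gL eta s t : S eta ->
    `|g eta (clamp T s) - g eta (clamp T t)| <= Lg * `|s - t|.
  move=> Se; have pr := Sp eta Se; case: (Se) => _ hM.
  have cs := clamp_itv s T0'; have ct := clamp_itv t T0'.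
  have cl := clamp_lip T s t.
  set s' := clamp T s in cs cl *; set t' := clamp T t in ct cl *.
  have l1 : `|eta s' - eta t'| <= M * `|s - t|.
    by apply: le_trans (hM _ _) _; rewrite ler_wpM2l.
  have l2 : `|e (p eta) s' - e (p eta) t'| <= L * `|s - t|.
    by apply: le_trans (eL _ _ _ cs ct pr) _; rewrite ler_wpM2l.
  have l3 : `|X (p eta) s' - X (p eta) t'| <= L * `|s - t|.
    by apply: le_trans (XL _ _ _ cs ct pr) _; rewrite ler_wpM2l.
  rewrite /g opprD addrACA -mulmxBr; apply: le_trans (ler_normD _ _) _.
  rewrite /Lg mulrDl; apply: lerD.
    apply: le_trans (AK _) _; rewrite -mulrA ler_wpM2l// opprD addrACA.
    apply: le_trans (ler_normD _ _) _; rewrite mulrDl; exact: lerD.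
  apply: le_trans (Nlip _ _ (Szr _ _ Se cs) (Szr _ _ Se ct)) _.
  rewrite -mulrA ler_wpM2l// /z opprD addrACA; apply: le_trans (ler_normD _ _) _.
  rewrite mulrDl; apply: lerD => //.
  rewrite opprD addrACA; apply: le_trans (ler_normD _ _) _.
  rewrite mulrDl; exact: lerD.
have gD eta eta' D s : S eta -> S eta' -> 0 <= s <= T ->
    (forall t, `|eta t - eta' t| <= D) ->
    T * `|g eta s - g eta' s| <= D / 2.
  move=> Se Se' sT HD; have pr := Sp eta Se; have pr' := Sp eta' Se'.
  have D0 : 0 <= D by apply: le_trans (HD 0).
  have pp : `|p eta - p eta'| <= D.
    by rewrite /p opprB addrC addrA subrK distrC.
  have d1 : `|e (p eta) s - e (p eta') s| <= D by apply: le_trans (eD _ _ _ sT pr pr') _.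
  have d2 : `|X (p eta) s - X (p eta') s| <= C * D.
    by apply: le_trans (XD _ _ _ sT pr pr') _; rewrite ler_wpM2l.
  have d3 := HD s.
  have a1 : `|A *m (eta s + e (p eta) s) - A *m (eta' s + e (p eta') s)| <= K * (2 * D).
    rewrite -mulmxBr; apply: le_trans (AK _) _; rewrite ler_wpM2l//.
    rewrite opprD addrACA; apply: le_trans (ler_normD _ _) _; lra.
  have a2 : `|N (z eta s) - N (z eta' s)| <= eps * ((C + 2) * D).
    apply: le_trans (Nlip _ _ (Szr _ _ Se sT) (Szr _ _ Se' sT)) _; rewrite ler_wpM2l//.
    rewrite /z opprD addrACA; apply: le_trans (ler_normD _ _) _.
    have := ler_normD (X (p eta) s - X (p eta') s) (e (p eta) s - e (p eta') s).
    rewrite opprD addrACA; lra.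
  have a3 : `|g eta s - g eta' s| <= K * (2 * D) + eps * ((C + 2) * D).
    by rewrite /g opprD addrACA; apply: le_trans (ler_normD _ _) _; exact: lerD.
  have a4 : T * `|g eta s - g eta' s| <= T * (K * (2 * D) + eps * ((C + 2) * D)).
    by rewrite ler_pM2l.
  have a5 : T * K * D <= 1 / 8 * D by rewrite ler_wpM2r.
  have a6 : T * (eps * (C + 2)) * D <= 1 / 8 * D by rewrite ler_wpM2r.
  lra.
have /choice[J HJ] : forall eta, exists P : R -> 'cV[R]_n.+1, S eta ->
    P 0 = 0 /\ forall t : R, 0 <= t -> is_derive t (1 : R) P (g eta (clamp T t)).
  move=> eta; have [Se|nS] := pselect (S eta); last by exists (fun=> 0).
  have [P HP] := exists_primitive_cV (fun s t => gL eta s t Se).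
  by exists P.
pose G eta t := J eta (clamp T t).
have JL eta s t : S eta -> 0 <= s -> s <= t -> `|J eta t - J eta s| <= M * (t - s).
  move=> Se s0 st; have [_ dJ] := HJ eta Se; apply: deriv_bound => // w /andP[sw _].
  eexists; last exact: dJ (le_trans s0 sw).
  by apply: gM => //; exact: clamp_itv.
have [eta Se etaE] : exists2 eta, S eta & forall t, G eta t = eta t.
  apply: (@pointwise_contraction _ _ _ S G (fun=> 0) (rho / 2)).
  - split=> [t|s t]; first by rewrite normr0 divr_ge0// ltW.
    by rewrite subrr normr0 mulr_ge0.
  - move=> eta Se; have [J0 _] := HJ eta Se; split.
      move=> t; have /andP[c0 cT] := clamp_itv t T0'.
      have := JL eta 0 (clamp T t) Se (lexx _) c0; rewrite J0 !subr0 => /le_trans; apply.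
      apply: (@le_trans _ _ (M * T)); first by rewrite ler_wpM2l.
      by rewrite /M le_eqVlt; apply/orP; left; apply/eqP; field; rewrite gt_eqF.
    move=> s t; apply: (@le_trans _ _ (M * `|clamp T s - clamp T t|)); last first.
      by rewrite ler_wpM2l// clamp_lip.
    have /andP[cs _] := clamp_itv s T0'; have /andP[ct _] := clamp_itv t T0'.
    rewrite /G; case: (leP (clamp T t) (clamp T s)) => h.
      by rewrite ger0_norm ?subr_ge0//; exact: JL.
    by rewrite distrC ltr0_norm ?subr_lt0// opprB; apply: JL => //; exact: ltW.
  - by move=> eta t [].
  - move=> u x Su ux; split=> [t|s t].
      have un : (fun k => `|u k t|) @ \oo --> `|x t| by apply: cvg_norm; exact: ux.
      apply: (closed_cvg (fun w : R => w <= rho / 2) _ _ _ un); first exact: closed_le.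
      by apply: nearW => k; case: (Su k).
    have un : (fun k => `|u k s - u k t|) @ \oo --> `|x s - x t|.
      by apply: cvg_norm; apply: cvgB; exact: ux.
    apply: (closed_cvg (fun w : R => w <= M * `|s - t|) _ _ _ un); first exact: closed_le.
    by apply: nearW => k; case: (Su k).
  move=> eta eta' D Se Se' HD t.
  have [J0 dJ] := HJ eta Se; have [J0' dJ'] := HJ eta' Se'.
  have /andP[c0 cT] := clamp_itv t T0'.
  have D0 : 0 <= D by apply: le_trans (HD 0).
  have := @deriv_bound _ _ (J eta - J eta') (D / 2 / T) 0 (clamp T t) c0.
  rewrite !fctE J0 J0' !subr0 => H; apply: le_trans (H _) _.
    move=> s /andP[s0 _]; eexists; last first.
      by apply: is_deriveB; [exact: dJ|exact: dJ'].
    rewrite ler_pdivlMr// mulrC; apply: gD => //; exact: clamp_itv.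
  apply: (@le_trans _ _ (D / 2 / T * T)); last by rewrite divfK// gt_eqF.
  by rewrite ler_wpM2l// !divr_ge0.
exists eta, M => /=; split.
- exact: Sp.
- have [J0 _] := HJ eta Se.
  by rewrite -etaE /G clamp_id ?lexx.
- by case: Se.
move=> t /andP[t0 tT].
have [_ dJ] := HJ eta Se.
have := dJ t (ltW t0); rewrite clamp_id ?(ltW t0) ?(ltW tT)// => dt.
apply: near_eq_is_derive dt; exists (Num.min t (T - t)) => /=.
  by rewrite lt_min t0 subr_gt0.
move=> s /=; rewrite lt_min !ltr_norml => /andP[/andP[s1 s2] /andP[s3 s4]].
by rewrite -etaE /G clamp_id//; lra.
Qed.

(** [X t p] is a solution of [X' = A X + W' f] from 0 to [p]. The equation is
written for [X - W f], so that the control [W'] itself does not occur. *)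
Definition steers (R : realType) (n : nat) (A : 'M[R]_n.+1) (f : 'cV[R]_n.+1)
    (T C : R) (X : R -> 'cV[R]_n.+1 -> 'cV[R]_n.+1) (W : R -> 'cV[R]_n.+1 -> R) : Prop :=
  [/\ (forall p, X 0 p = 0) /\ (forall p, X T p = p),
      (forall t p p', X t (p - p') = X t p - X t p') /\
        (forall t p p', W t (p - p') = W t p - W t p'),
      (forall t p, is_derive t (1 : R) (fun s => X s p - W s p *: f) (A *m X t p)) &
      forall s t p, 0 <= s <= T -> 0 <= t <= T ->
        [/\ `|X t p| <= C * `|p|, `|X s p - X t p| <= C * `|p| * `|s - t| &
            `|W s p - W t p| <= C * `|p| * `|s - t|]].

Lemma lip_abs_continuous (R : realType) (n : nat) (a b L : R) (x : R -> 'cV[R]_n.+1) :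
  (forall s t, a <= s <= b -> a <= t <= b -> `|x s - x t| <= L * `|s - t|) ->
  abs_continuous a b x.
Proof.
move=> xL e e0; have L0 : 0 < `|L| + 1 by rewrite ltr_wpDl.
exists (e / (`|L| + 1)); first exact: divr_gt0.
move=> k l r lr _; rewrite ltr_pdivlMr// => H; apply: le_lt_trans H.
rewrite mulr_suml; apply: ler_sum => i _; have [h1 [h2 h3]] := lr i.
apply: (le_trans (xL _ _ _ _)); rewrite ?h3 ?h1 ?(le_trans h1)// ?(le_trans h2)//.
rewrite ger0_norm ?subr_ge0// mulrC ler_wpM2l ?subr_ge0//.
by rewrite (le_trans (ler_norm L))// lerDl.
Qed.

Lemma is_derive_scale (R : realType) (n : nat) (s : R -> R) (f : 'cV[R]_n.+1) (t u : R) :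
  is_derive t (1 : R) s u -> is_derive t (1 : R) (fun r => s r *: f) (u *: f).
Proof.
move=> ds; apply/is_derive_coord => i.
rewrite (_ : (fun r => _) = (fun r => s r * f i 0)); last first.
  by apply/funext => r; rewrite !mxE.
have := is_deriveM_fun ds (is_derive_cst (f i 0) t 1).
by rewrite mulr0 addr0 mxE.
Qed.

Lemma bounded_control (R : realType) (U : set R) (a b T : R) (u : R -> R) :
  U a -> U b -> (forall t, u t = a \/ u t = b) -> measurable_fun setT u ->
  admissible_control U T u.
Proof.
move=> Ua Ub uab mu; split; first by move=> t _; case: (uab t) => ->.
have fin : (@lebesgue_measure R `[0%R, T]%classic < +oo)%E.
  rewrite lebesgue_measure_itv /=; case: ifP => _; last exact: ltry.
  by rewrite -EFinB ltry.
apply: measurable_bounded_integrable => //.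
- exact: measurable_funTS.
exists (`|a| + `|b|); split; first exact: num_real.
move=> M hM t _ /=; apply: le_trans (ltW hM).
by case: (uab t) => ->; rewrite ?lerDl ?lerDr.
Qed.

(** Order of choices: [T] makes [T K] small, the steering curves on [[0, T]] then
give [C], which fixes [eps] and the radius [r]; [rho] bounds the targets, so that
the slopes of [W] stay between [a] and [b]; the mesh [h] comes last. *)
Lemma bang_bang_STLC (R : realType) (n : nat) (F : 'cV[R]_n.+1 -> 'cV[R]_n.+1)
    (f : 'cV[R]_n.+1) (A : 'M[R]_n.+1) (U : set R) (a b : R) :
  F 0 = 0 ->
  (forall eps : R, 0 < eps -> exists2 r : R, 0 < r &
     forall z z', `|z| <= r -> `|z'| <= r ->
       `|(F z - A *m z) - (F z' - A *m z')| <= eps * `|z - z'|) ->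
  U a -> U b -> a < 0 -> 0 < b ->
  (forall T : R, 0 < T -> exists C X W, 0 <= C /\ steers A f T C X W) ->
  STLC F f U 0.
Proof.
move=> F0 Flip Ua Ub a0 b0 steer T1 T10.
have [K K0 AK] := mulmx_bounded A.
pose T := Num.min T1 (1 / (8 * K)).
have T0 : 0 < T by rewrite lt_min T10 divr_gt0// mulr_gt0.
have TT1 : T <= T1 by rewrite ge_min lexx.
have TK : T * K <= 1 / 8.
  rewrite -ler_pdivlMr//; apply: (@le_trans _ _ (1 / (8 * K))).
    by rewrite ge_min lexx orbT.
  by rewrite invfM mulrA.
clearbody T.
have [C [X [W [C0 [[X0 XT] [Xlin Wlin] dX bd]]]]] := steer T T0.
pose eps := 1 / (8 * (T * (C + 2))).
have C2 : 0 < C + 2 by lra.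
have eps0 : 0 < eps by rewrite divr_gt0// !mulr_gt0.
have TE : T * (eps * (C + 2)) <= 1 / 8.
  by rewrite le_eqVlt; apply/orP; left; apply/eqP; rewrite /eps; field; rewrite !gt_eqF.
have [r r0 Nlip] := Flip eps eps0.
have C1 : 0 < C + 1 by lra.
pose rho := Num.min (r / (C + 1)) (Num.min (- a) b / (C + 1)).
have na0 : 0 < - a by lra.
have rho0 : 0 < rho by rewrite lt_min !divr_gt0// lt_min na0.
have Cr : (C + 1) * rho <= r by rewrite mulrC -ler_pdivlMr// ge_min lexx.
have Cab : C * rho <= Num.min (- a) b.
  apply: (@le_trans _ _ ((C + 1) * rho)); first by rewrite ler_wpM2r ?(ltW rho0)//; lra.
  by rewrite mulrC -ler_pdivlMr// ge_min lexx orbT.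
move: Cab; rewrite le_min => /andP[Ca Cb].
clearbody rho.
(* The mesh must satisfy [(b - a) h |f| <= rho / 8] and [C h |f| <= 1]. *)
pose Q := ((b - a) * `|f| * 8 / rho + C * `|f|) * T.
have Q0 : 0 <= Q.
  rewrite mulr_ge0 ?(ltW T0)// addr_ge0 ?mulr_ge0 ?invr_ge0 ?(ltW rho0)//; lra.
pose m := Num.bound Q.
pose h := T / m.+1%:R.
have h0 : 0 < h by rewrite divr_gt0.
have mh : m.+1%:R * h = T by rewrite /h mulrC divfK// pnatr_eq0.
have hQ : ((b - a) * `|f| * 8 / rho + C * `|f|) * h <= 1.
  rewrite /h mulrA ler_pdivrMr// mul1r -/Q.
  by apply/ltW/(lt_trans (archi_boundP Q0)); rewrite ltr_nat.
have hb0 : 0 <= (b - a) * h by rewrite mulr_ge0 ?(ltW h0)//; lra.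
have hC0 : 0 <= C * h by rewrite mulr_ge0 ?(ltW h0).
have h1 : (b - a) * h * `|f| <= rho / 8.
  have e1 : (b - a) * `|f| * 8 / rho * h <= 1.
    apply: le_trans hQ; rewrite ler_pM2r// lerDl mulr_ge0//.
  have -> : (b - a) * h * `|f| = ((b - a) * `|f| * 8 / rho * h) * (rho / 8).
    by field; rewrite gt_eqF.
  by rewrite ler_piMl// divr_ge0// ltW.
have h2 : C * h * `|f| <= 1.
  have -> : C * h * `|f| = C * `|f| * h by ring.
  apply: le_trans hQ; rewrite ler_pM2r// lerDr mulr_ge0 ?invr_ge0 ?(ltW rho0)//.
  by rewrite !mulr_ge0//; lra.
clearbody h.
pose v p t := sawtooth a b h (fun s => W s p) m t.
pose e p t : 'cV[R]_n.+1 := (v p t - W t p) *: f.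
have Wlip p s t : `|p| <= rho -> 0 <= s <= T -> 0 <= t <= T ->
    `|W s p - W t p| <= C * rho * `|s - t|.
  move=> pr sT tT; have [_ _ w] := bd s t p sT tT; apply: le_trans w _.
  by rewrite ler_wpM2r// ler_wpM2l.
have slopes p : `|p| <= rho -> slopes_between a b T (fun s => W s p).
  move=> pr s t s0 st tT.
  have := Wlip p t s pr; rewrite (le_trans s0 st) tT s0 (le_trans st tT) => /(_ isT isT).
  rewrite (ger0_norm (x := t - s)) ?subr_ge0// ler_norml => /andP[w1 w2].
  have ts : 0 <= t - s by rewrite subr_ge0.
  have := ler_wpM2r ts Ca; have := ler_wpM2r ts Cb; lra.
have slopes' p : `|p| <= rho -> slopes_between a b (m.+1%:R * h) (fun s => W s p).
  by rewrite mh; exact: slopes.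
have eb p t : 0 <= t <= T -> `|p| <= rho -> `|e p t| <= rho / 8.
  move=> tT pr; rewrite normrZ; apply: le_trans h1; rewrite ler_wpM2r//.
  have := sawtooth_near h0 (slopes' p pr); rewrite mh => /(_ t tT) /andP[s1 s2].
  by rewrite ger0_norm; rewrite /v; lra.
have eD p p' t : 0 <= t <= T -> `|p| <= rho -> `|p'| <= rho ->
    `|e p t - e p' t| <= `|p - p'|.
  move=> tT pr pr'; rewrite /e -scalerBl normrZ.
  have := @sawtooth_param_lip _ a b h (C * `|p - p'|) _ _ m t h0 (slopes' p pr) (slopes' p' pr').
  rewrite mh => H.
  have {}H : `|(v p t - W t p) - (v p' t - W t p')| <= C * `|p - p'| * h.
    apply: H => // r' s' rT sT; rewrite -!Wlin.
    by have [_ _] := bd r' s' (p - p') rT sT.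
  apply: (@le_trans _ _ (C * `|p - p'| * h * `|f|)); first by rewrite ler_wpM2r.
  have -> : C * `|p - p'| * h * `|f| = (C * h * `|f|) * `|p - p'| by ring.
  by rewrite ler_piMl.
pose L := C * rho + (`|a| + `|b| + C * rho) * `|f|.
have L0 : 0 <= L.
  have Cr0 : 0 <= C * rho by rewrite mulr_ge0// ltW.
  by rewrite addr_ge0// mulr_ge0// !addr_ge0.
have XL p s t : 0 <= s <= T -> 0 <= t <= T -> `|p| <= rho ->
    `|X s p - X t p| <= L * `|s - t|.
  move=> sT tT pr; have [_ x _] := bd s t p sT tT; apply: le_trans x _.
  rewrite ler_wpM2r//; apply: (@le_trans _ _ (C * rho)); first by rewrite ler_wpM2l.
  rewrite /L lerDl mulr_ge0// !addr_ge0//.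
  by rewrite mulr_ge0// ltW.
have eL p s t : 0 <= s <= T -> 0 <= t <= T -> `|p| <= rho ->
    `|e p s - e p t| <= L * `|s - t|.
  move=> sT tT pr; rewrite /e -scalerBl normrZ.
  have w := Wlip p s t pr sT tT.
  have z := sawtooth_lip a b h (fun s => W s p) m s t.
  apply: (@le_trans _ _ ((`|a| + `|b| + C * rho) * `|s - t| * `|f|)).
    rewrite ler_wpM2r//.
    have -> : v p s - W s p - (v p t - W t p) = (v p s - v p t) - (W s p - W t p) by ring.
    apply: le_trans (ler_normB _ _) _; rewrite [X in _ <= X]mulrDl; exact: lerD.
  by rewrite mulrAC ler_wpM2r// /L lerDr mulr_ge0// ltW.
have N0 : F 0 - A *m 0 = 0 by rewrite F0 mulmx0 subrr.
apply/nbhs_ballP; exists (rho / 2) => /=; first by rewrite divr_gt0.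
move=> q; rewrite -ball_normE /= sub0r normrN => qr.
exists T; first by rewrite (ltW T0).
have Xb p t : 0 <= t <= T -> `|p| <= rho -> `|X t p| <= C * `|p|.
  by move=> tT _; have [] := bd t t p tT tT.
have XD p p' t : 0 <= t <= T -> `|p| <= rho -> `|p'| <= rho ->
    `|X t p - X t p'| <= C * `|p - p'|.
  by move=> tT _ _; rewrite -Xlin; have [] := bd t t (p - p') tT tT.
have [eta [M /= [pr eta0 etaL deta]]] :=
  forced_fixed_point (X := fun p t => X t p) (e := e) T0 rho0 (ltW eps0) C0 L0 (ltW K0) AK
    N0 Nlip TK TE Cr Xb XD XL eb eD eL (ltW qr).
set p := q - eta T in pr deta.
have ba : a < b by exact: lt_trans b0.
have [u [uab mu dv]] := sawtooth_control ba h0 (slopes' p pr).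
rewrite mh in dv.
have [v0 vT] := sawtooth_ends h0 (slopes' p pr).
rewrite mh in vT.
exists (fun t => X t p + e p t + eta t); split.
- split.
    apply: (@lip_abs_continuous _ _ _ _ (L + L + M)) => s t sT tT.
    rewrite opprD addrACA; apply: le_trans (ler_normD _ _) _.
    rewrite [X in _ <= X]mulrDl; apply: lerD; last exact: etaL.
    rewrite opprD addrACA; apply: le_trans (ler_normD _ _) _.
    by rewrite [X in _ <= X]mulrDl; apply: lerD; [exact: XL|exact: eL].
  exists u; first exact: (@bounded_control _ U a b T u).
  apply: ae_imply dv => t H tT; have [t0T du] := H tT.
  have dd := is_deriveD (is_deriveD (dX t p) (is_derive_scale f du)) (deta t t0T).
  apply: (is_derive_eq (f := fun t => X t p + e p t + eta t)).
    rewrite (_ : (fun s => X s p + e p s + eta s) =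
      (fun s => X s p - W s p *: f) + (fun s => v p s *: f) + eta); first exact: dd.
    apply/funext => s; rewrite !fctE /e scalerBl; congr (_ + _).
    by rewrite [v p s *: f - _]addrC addrA.
  set z := X t p + e p t + eta t.
  have -> : A *m (eta t + e p t) = A *m z - A *m X t p.
    rewrite -mulmxBr; congr (_ *m _); rewrite /z addrAC -[X t p + _ + _]addrA.
    by rewrite addrAC addrC addrA subrK addrC.
  rewrite -/z; move: (A *m z) (A *m X t p) (F z) => w x g.
  by apply/matrixP => i j; rewrite !mxE; ring.
- by rewrite X0 /e /v v0 subrr scale0r eta0 !addr0.
- by rewrite XT /e /v vT subrr scale0r addr0 /p subrK.
Qed.

(** * Steering a controllable three-dimensional linear system *)

Lemma det_mx22 (R : comNzRingType) (M : 'M[R]_2) :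
  \det M = M 0 0 * M 1 1 - M 0 1 * M 1 0.
Proof.
rewrite (expand_det_row M 0) !big_ord_recl big_ord0 /cofactor !det_mx11 !mxE /=.
have -> : lift ord0 (ord0 : 'I_1) = 1 :> 'I_2 by apply/val_inj.
have -> : lift 1 (0 : 'I_1) = 0 :> 'I_2 by apply/val_inj.
by rewrite /bump /=; ring.
Qed.
Lemma det_mx33 (R : comNzRingType) (M : 'M[R]_3) :
  \det M = M 0 0 * (M 1 1 * M 2 2 - M 1 2 * M 2 1)
         - M 0 1 * (M 1 0 * M 2 2 - M 1 2 * M 2 0)
         + M 0 2 * (M 1 0 * M 2 1 - M 1 1 * M 2 0).
Proof.
rewrite (expand_det_row M 0) !big_ord_recl big_ord0 /cofactor !det_mx22 !mxE /=.
have -> : lift ord0 (ord0 : 'I_2) = 1 :> 'I_3 by apply/val_inj.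
have -> : lift ord0 (1 : 'I_2) = 2 :> 'I_3 by apply/val_inj.
have -> : lift ord0 (lift ord0 (ord0 : 'I_1)) = 2 :> 'I_3 by apply/val_inj.
have -> : lift (1 : 'I_3) (0 : 'I_2) = 0 :> 'I_3 by apply/val_inj.
have -> : lift (1 : 'I_3) (1 : 'I_2) = 2 :> 'I_3 by apply/val_inj.
have -> : lift (2 : 'I_3) (0 : 'I_2) = 0 :> 'I_3 by apply/val_inj.
have -> : lift (2 : 'I_3) (1 : 'I_2) = 1 :> 'I_3 by apply/val_inj.
by rewrite /= /bump /=; ring.
Qed.

Lemma poly_lip (R : realType) (T : R) (p : {poly R}) : 0 <= T ->
  exists2 L : R, 0 <= L & forall s t, 0 <= s <= T -> 0 <= t <= T ->
    `|p.[t]| <= L /\ `|p.[s] - p.[t]| <= L * `|s - t|.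
Proof.
move=> T0; elim/poly_ind: p => [|p c [L L0 IH]].
  by exists 0 => // s t _ _; rewrite !horner0 subrr normr0 mul0r.
have c0 := normr_ge0 c.
exists (L * T + L + `|c|); first by rewrite !addr_ge0// mulr_ge0.
move=> s t sT tT; have [pt pst] := IH s t sT tT.
have /andP[s0 sT'] := sT; have /andP[t0 tT'] := tT.
rewrite !hornerE; split.
  apply: le_trans (ler_normD _ _) _; rewrite normrM (ger0_norm t0).
  have : `|p.[t]| * t <= L * T by apply: ler_pM.
  lra.
have -> : p.[s] * s + c - (p.[t] * t + c) = (p.[s] - p.[t]) * s + p.[t] * (s - t) by ring.
apply: le_trans (ler_normD _ _) _; rewrite !normrM (ger0_norm s0).
have h1 : `|p.[s] - p.[t]| * s <= L * `|s - t| * T by apply: ler_pM.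
have h2 : `|p.[t]| * `|s - t| <= L * `|s - t| by rewrite ler_wpM2r.
have h3 : 0 <= `|c| * `|s - t| by rewrite mulr_ge0.
lra.
Qed.

(** Writing the linear system with characteristic coefficients [a0], [a1], [a2] in
controller form, its trajectories are parametrised by a flat output [H], the
control being [H''' + a2 H'' + a1 H' + a0 H], the derivative of [W]. *)
Lemma flat_curve (R : realType) (n : nat) (A : 'M[R]_n.+1)
    (c0 c1 f : 'cV[R]_n.+1) (a0 a1 a2 : R) (P : {poly R}) (t : R) :
  c1 = A *m f + a2 *: f -> c0 = A *m c1 + a1 *: f -> A *m c0 = - a0 *: f ->
  let H := P^`() in
  let X t := H.[t] *: c0 + H^`().[t] *: c1 + H^`()^`().[t] *: f in
  let W t := H^`()^`().[t] + a2 * H^`().[t] + a1 * H.[t] + a0 * P.[t] in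
  is_derive t (1 : R) (fun s => X s - W s *: f) (A *m X t).
Proof.
move=> E1 E0 E H X W.
have E0' : A *m c1 = c0 - a1 *: f by rewrite E0 addrK.
have E1' : A *m f = c1 - a2 *: f by rewrite E1 addrK.
have -> : A *m X t = H.[t] *: (- a0 *: f) + H^`().[t] *: (c0 - a1 *: f) +
   H^`()^`().[t] *: (c1 - a2 *: f).
  by rewrite /X !mulmxDr -!scalemxAr E E0' E1'.
rewrite (_ : (fun s => _) = (fun s => H.[s] *: (c0 - a1 *: f)) +
   (fun s => H^`().[s] *: (c1 - a2 *: f)) + (fun s => P.[s] *: (- a0 *: f))); last first.
  apply/funext => s; rewrite !fctE /X /W.
  by apply/matrixP => i j; rewrite !mxE; ring.
have d (Q : {poly R}) (v : 'cV[R]_n.+1) : is_derive t (1 : R) (fun s => Q.[s] *: v) (Q^`().[t] *: v).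
  by apply: is_derive_scale; exact: is_derive_poly.
have := is_deriveD (is_deriveD (d H (c0 - a1 *: f)) (d H^`() (c1 - a2 *: f)))
  (d P (- a0 *: f)).
by move=> dd; apply: is_derive_eq dd _; rewrite addrC addrA.
Qed.

Lemma deriv_monomial (R : realType) (k : nat) (t : R) :
  let P : {poly R} := 'X^(k.+4) in
  [/\ P^`().[t] = k.+4%:R * t ^+ k.+3,
      P^`()^`().[t] = (k.+4 * k.+3)%:R * t ^+ k.+2 &
      P^`()^`()^`().[t] = (k.+4 * k.+3 * k.+2)%:R * t ^+ k.+1].
Proof.
rewrite /= !(derivXn, derivMn) /= -!mulrnA; split.
- by rewrite hornerMn hornerXn -mulr_natl.
- by rewrite hornerMn hornerXn -mulr_natl mulnC.
- by rewrite hornerMn hornerXn -mulr_natl; congr (_%:R * _); ring.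
Qed.

(** The flat outputs are combinations of [t^3], [t^4], [t^5]: they vanish to order
three at 0, and their jets of order two at [T] are independent, so the endpoint
map [M] is invertible. *)
Lemma flat_steering (R : realType) (A : 'M[R]_3) (c0 c1 f : 'cV[R]_3) (a0 a1 a2 : R) :
  c1 = A *m f + a2 *: f -> c0 = A *m c1 + a1 *: f -> A *m c0 = - a0 *: f ->
  \det (\matrix_(i, j) [:: c0 i 0; c1 i 0; f i 0]`_j) != 0 ->
  forall T : R, 0 < T -> exists C X W, 0 <= C /\ steers A f T C X W.
Proof.
move=> E1 E0 E detK T T0; set Km := \matrix_(i, j) _ in detK.
pose P (i : 'I_3) : {poly R} := 'X^(i.+4).
pose Hm : 'M[R]_3 := \matrix_(r, i) [:: (P i)^`().[T]; (P i)^`()^`().[T]; (P i)^`()^`()^`().[T]]`_r.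
pose psi i t := (P i)^`().[t] *: c0 + (P i)^`()^`().[t] *: c1 + (P i)^`()^`()^`().[t] *: f.
pose om i t := (P i)^`()^`()^`().[t] + a2 * (P i)^`()^`().[t] + a1 * (P i)^`().[t] + a0 * (P i).[t].
have detH : \det Hm != 0.
  have -> : \det Hm = 240 * T ^+ 9.
    have [p00 p01 p02] := deriv_monomial 0 T.
    have [p10 p11 p12] := deriv_monomial 1 T.
    have [p20 p21 p22] := deriv_monomial 2 T.
    rewrite det_mx33 !mxE /P.
    rewrite (_ : nat_of_ord (0 : 'I_3) = 0%N)// (_ : nat_of_ord (1 : 'I_3) = 1%N)//.
    rewrite (_ : nat_of_ord (2 : 'I_3) = 2%N)// p00 p01 p02 p10 p11 p12 p20 p21 p22 /=.
    by ring.
  by rewrite mulf_neq0 ?expf_neq0 ?pnatr_eq0 ?gt_eqF.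
pose M := Km *m Hm.
have Mu : M \in unitmx by rewrite unitmxE det_mulmx unitfE mulf_neq0.
have psiT i j : psi i T j 0 = M j i.
  rewrite /M [RHS]mxE !big_ord_recl big_ord0 /psi !mxE /=; ring.
pose co (p : 'cV[R]_3) i : R := (invmx M *m p) i 0.
have coB p p' i : co (p - p') i = co p i - co p' i by rewrite /co mulmxBr !mxE.
have [K K0 coK] := mulmx_bounded (invmx M).
have cob p i : `|co p i| <= K * `|p|.
  by apply: le_trans (coK p); exact: cV_norm_coord.
pose X t p := \sum_i co p i *: psi i t.
pose W t p := \sum_i co p i * om i t.
have lipX i : exists2 L : R, 0 <= L & forall s t, 0 <= s <= T -> 0 <= t <= T ->
    [/\ `|psi i t| <= L, `|psi i s - psi i t| <= L * `|s - t| &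
        `|om i s - om i t| <= L * `|s - t|].
  have [L0 L00 H0] := poly_lip (P i) (ltW T0).
  have [L1 L10 H1] := poly_lip (P i)^`() (ltW T0).
  have [L2 L20 H2] := poly_lip (P i)^`()^`() (ltW T0).
  have [L3 L30 H3] := poly_lip (P i)^`()^`()^`() (ltW T0).
  exists (L1 * `|c0| + L2 * `|c1| + L3 * `|f| + (L3 + `|a2| * L2 + `|a1| * L1 + `|a0| * L0)).
    by rewrite !addr_ge0// mulr_ge0.
  move=> s t sT tT; have [b0 l0] := H0 s t sT tT; have [b1 l1] := H1 s t sT tT.
  have [b2 l2] := H2 s t sT tT; have [b3 l3] := H3 s t sT tT.
  have st := normr_ge0 (s - t).
  have tri (V : normedModType R) (x y z : V) : `|x + y + z| <= `|x| + `|y| + `|z|.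
    by apply: le_trans (ler_normD _ _) _; rewrite lerD2r ler_normD.
  have k0 : 0 <= L1 * `|c0| + L2 * `|c1| + L3 * `|f| by rewrite !addr_ge0// mulr_ge0.
  have k1 : 0 <= L3 + `|a2| * L2 + `|a1| * L1 + `|a0| * L0 by rewrite !addr_ge0// mulr_ge0.
  split.
  - apply: (@le_trans _ _ (L1 * `|c0| + L2 * `|c1| + L3 * `|f|)); last by rewrite lerDl.
    apply: le_trans (tri _ _ _ _) _; rewrite !normrZ.
    by apply: lerD; [apply: lerD|]; rewrite ler_wpM2r.
  - apply: (@le_trans _ _ ((L1 * `|c0| + L2 * `|c1| + L3 * `|f|) * `|s - t|)); last first.
      by rewrite ler_wpM2r// lerDl.
    have -> : psi i s - psi i t = ((P i)^`().[s] - (P i)^`().[t]) *: c0 +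
        ((P i)^`()^`().[s] - (P i)^`()^`().[t]) *: c1 +
        ((P i)^`()^`()^`().[s] - (P i)^`()^`()^`().[t]) *: f.
      by apply/matrixP => a b; rewrite !mxE; ring.
    apply: le_trans (tri _ _ _ _) _; rewrite !normrZ !mulrDl.
    by apply: lerD; [apply: lerD|]; rewrite mulrAC ler_wpM2r.
  - apply: (@le_trans _ _ ((L3 + `|a2| * L2 + `|a1| * L1 + `|a0| * L0) * `|s - t|)); last first.
      by rewrite ler_wpM2r// lerDr.
    have -> : om i s - om i t = ((P i)^`()^`()^`().[s] - (P i)^`()^`()^`().[t]) +
        a2 * ((P i)^`()^`().[s] - (P i)^`()^`().[t]) +
        a1 * ((P i)^`().[s] - (P i)^`().[t]) + a0 * ((P i).[s] - (P i).[t]).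
      by rewrite /om; ring.
    apply: le_trans (ler_normD _ _) _; rewrite [X in _ <= X]mulrDl; apply: lerD; last first.
      by rewrite normrM -mulrA ler_wpM2l.
    apply: (le_trans (tri R^o _ _ _)); rewrite !normrM !mulrDl.
    by apply: lerD; [apply: lerD|] => //; rewrite -mulrA ler_wpM2l.
have /choice[Li HLi] : forall i, exists L : R, 0 <= L /\ forall s t, 0 <= s <= T -> 0 <= t <= T ->
    [/\ `|psi i t| <= L, `|psi i s - psi i t| <= L * `|s - t| &
        `|om i s - om i t| <= L * `|s - t|].
  by move=> i; have [L L0 H] := lipX i; exists L.
exists (K * \sum_i Li i), X, W; split.
  by rewrite mulr_ge0 ?(ltW K0)// sumr_ge0// => i _; case: (HLi i).
split.
- split=> p; rewrite /X.
    rewrite big1// => i _; rewrite /psi /P.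
    have [z0 z1 z2] := deriv_monomial i (0 : R).
    by rewrite z0 z1 z2 !exprS !mul0r !mulr0 !scale0r !addr0 scaler0.
  apply/matrixP => j k; rewrite ord1 summxE.
  transitivity ((M *m (invmx M *m p)) j 0); last by rewrite mulKVmx.
  by rewrite mxE; apply: eq_bigr => i _; rewrite mxE psiT mulrC.
- split=> t p p'.
    by rewrite /X -sumrB; apply: eq_bigr => i _; rewrite coB scalerBl.
  by rewrite /W -sumrB; apply: eq_bigr => i _; rewrite coB mulrBl.
- move=> t p.
  rewrite (_ : (fun s => _) = \sum_i (fun s => co p i *: (psi i s - om i s *: f))); last first.
    apply/funext => s; rewrite fct_sumE /X /W scaler_suml -sumrB; apply: eq_bigr => i _.
    by rewrite scalerBr scalerA.
  rewrite /X mulmx_sumr; apply: is_derive_sum => i.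
  rewrite -scalemxAr; apply: is_deriveZ.
  exact: (flat_curve (P i) t E1 E0 E).
move=> s t p sT tT; have p0 := normr_ge0 p.
have sumb (V : normedModType R) (v : 'I_3 -> V) w : (forall i, `|v i| <= Li i * w) ->
   `|\sum_i co p i *: v i| <= K * (\sum_i Li i) * `|p| * w.
  move=> H; apply: le_trans (ler_norm_sum _ _ _) _.
  rewrite mulrAC [K * _ * w]mulrAC mulrAC mulr_sumr; apply: ler_sum => i _.
  rewrite normrZ; apply: (@le_trans _ _ ((K * `|p|) * (Li i * w))); first exact: ler_pM.
  by rewrite le_eqVlt; apply/orP; left; apply/eqP; ring.
split.
- rewrite -[X in _ <= X]mulr1; apply: sumb => i; rewrite mulr1.
  by have [_ /(_ s t sT tT)[]] := HLi i.
- rewrite /X -sumrB; under eq_bigr do rewrite -scalerBr; apply: sumb => i.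
  by have [_ /(_ s t sT tT)[]] := HLi i.
- rewrite /W -sumrB; under eq_bigr do rewrite -mulrBr.
  apply: (sumb R^o (fun i => om i s - om i t)) => i.
  by have [_ /(_ s t sT tT)[]] := HLi i.
Qed.

(** * The Lorenz system with a non-exceptional control vector *)

Lemma hull_neg_pos (R : realType) (U : set R) : interior (convex_hull U) 0 ->
  exists a b : R, [/\ U a, U b, a < 0 & 0 < b].
Proof.
move=> /nbhs_ballP[e /= e0 He].
have hull y : `|y| < e -> convex_hull U y by move=> ye; apply: He; rewrite -ball_normE /= sub0r normrN.
have e2 : `|e / 2| < e by rewrite ger0_norm; lra.
have [n1 [w1 [v1 [U1 w10 _ E1]]]] := hull (- (e / 2)) ltac:(by rewrite normrN).
have [n2 [w2 [v2 [U2 w20 _ E2]]]] := hull (e / 2) e2.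
have [a [Ua a0]] : exists a, U a /\ a < 0.
  apply: contrapT => H; have : 0 <= \sum_i w1 i * v1 i.
    apply: sumr_ge0 => i _; apply: mulr_ge0 => //; rewrite leNgt; apply/negP => vi.
    by apply: H; exists (v1 i).
  by rewrite -E1; lra.
have [b [Ub b0]] : exists b, U b /\ 0 < b.
  apply: contrapT => H; have : \sum_i w2 i * v2 i <= 0.
    apply: sumr_le0 => i _; apply: mulr_ge0_le0 => //; rewrite leNgt; apply/negP => vi.
    by apply: H; exists (v2 i).
  by rewrite -E2; lra.
by exists a, b.
Qed.

Lemma lorenz_matrixE (R : realType) (beta sigma rho : R) (z : 'cV[R]_3) :
  [/\ (lorenz_matrix beta sigma rho *m z) 0 0 = - sigma * z 0 0 + sigma * z 1 0,
      (lorenz_matrix beta sigma rho *m z) 1 0 = rho * z 0 0 - z 1 0 &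
      (lorenz_matrix beta sigma rho *m z) 2 0 = - beta * z 2 0].
Proof.
rewrite !mxE !big_ord_recl !big_ord0 !mxE /=.
have -> : lift ord0 (ord0 : 'I_2) = 1 :> 'I_3 by apply/val_inj.
have -> : lift ord0 (lift ord0 (ord0 : 'I_1)) = 2 :> 'I_3 by apply/val_inj.
by split; ring.
Qed.

(** The coefficients are those of the characteristic polynomial
[(X^2 + (sigma + 1) X + sigma (1 - rho)) (X + beta)]. *)
Lemma lorenz_steering (R : realType) (beta sigma rho : R) (f : 'cV[R]_3) :
  f 2 0 != 0 ->
  rho * f 0 0 ^+ 2 + (sigma - 1) * (f 0 0 * f 1 0) - sigma * f 1 0 ^+ 2 != 0 ->
  lorenz_s beta sigma rho != 0 ->
  forall T : R, 0 < T -> exists C X W,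
    0 <= C /\ steers (lorenz_matrix beta sigma rho) f T C X W.
Proof.
move=> f3 Q0 s0.
set A := lorenz_matrix beta sigma rho.
have [c1 c1E] : exists c1, c1 = A *m f + (sigma + 1 + beta) *: f by eexists.
have [c0 c0E] : exists c0,
    c0 = A *m c1 + (sigma * (1 - rho) + beta * (sigma + 1)) *: f by eexists.
have [f0 f1 f2] := lorenz_matrixE beta sigma rho f.
have [g0 g1 g2] := lorenz_matrixE beta sigma rho c1.
have [h0 h1 h2] := lorenz_matrixE beta sigma rho c0.
have e1 i : c1 i 0 = (A *m f) i 0 + (sigma + 1 + beta) * f i 0 by rewrite c1E mxE [X in _ + X]mxE.
have e0 i : c0 i 0 = (A *m c1) i 0 + (sigma * (1 - rho) + beta * (sigma + 1)) * f i 0.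
  by rewrite c0E mxE [X in _ + X]mxE.
apply: (@flat_steering _ A c0 c1 f (beta * sigma * (1 - rho))
  (sigma * (1 - rho) + beta * (sigma + 1)) (sigma + 1 + beta)) => //.
  apply/matrixP => i j; rewrite ord1 [RHS]mxE.
  apply: (ord3P (P := fun i => (A *m c0) i 0 = _ * f i 0)) i;
    rewrite ?h0 ?h1 ?h2 !e0 ?g0 ?g1 ?g2 !e1 ?f0 ?f1 ?f2; ring.
have -> : \det (\matrix_(i, j) [:: c0 i 0; c1 i 0; f i 0]`_j) =
    - (f 2 0 * lorenz_s beta sigma rho *
     (rho * f 0 0 ^+ 2 + (sigma - 1) * (f 0 0 * f 1 0) - sigma * f 1 0 ^+ 2)).
  rewrite det_mx33 !mxE /= !e0 ?g0 ?g1 ?g2 !e1 ?f0 ?f1 ?f2 /lorenz_s; ring.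
by rewrite oppr_eq0 !mulf_neq0.
Qed.

Lemma lorenz_remainder (R : realType) (beta sigma rho : R) (eps : R) : 0 < eps ->
  exists2 r : R, 0 < r & forall z z' : 'cV[R]_3, `|z| <= r -> `|z'| <= r ->
    `|(lorenz_drift beta sigma rho z - lorenz_matrix beta sigma rho *m z) -
      (lorenz_drift beta sigma rho z' - lorenz_matrix beta sigma rho *m z')|
    <= eps * `|z - z'|.
Proof.
move=> e0; exists (eps / 2); first exact: divr_gt0.
move=> z z' zr z'r.
have NE (y : 'cV[R]_3) : lorenz_drift beta sigma rho y - lorenz_matrix beta sigma rho *m y =
    vec3 0 (- (y 0 0 * y 2 0)) (y 0 0 * y 1 0) by rewrite /lorenz_drift addrC addKr.
rewrite !NE.
have [E0 E1 E2] := vec3E 0 (- (z 0 0 * z 2 0)) (z 0 0 * z 1 0).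
have [E0' E1' E2'] := vec3E 0 (- (z' 0 0 * z' 2 0)) (z' 0 0 * z' 1 0).
have prod i j : `|z i 0 * z j 0 - z' i 0 * z' j 0| <= eps * `|z - z'|.
  have -> : z i 0 * z j 0 - z' i 0 * z' j 0 =
    (z i 0 - z' i 0) * z j 0 + z' i 0 * (z j 0 - z' j 0) by ring.
  have d k : `|z k 0 - z' k 0| <= `|z - z'|.
    by apply: le_trans (cV_norm_coord (z - z') k); rewrite !mxE.
  have h1 : `|z i 0 - z' i 0| * `|z j 0| <= `|z - z'| * (eps / 2).
    by apply: ler_pM => //; apply: le_trans zr; exact: cV_norm_coord.
  have h2 : `|z' i 0| * `|z j 0 - z' j 0| <= eps / 2 * `|z - z'|.
    by apply: ler_pM => //; apply: le_trans z'r; exact: cV_norm_coord.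
  by apply: le_trans (ler_normD _ _) _; rewrite !normrM; lra.
have cB (u v : 'cV[R]_3) i : (u - v) i 0 = u i 0 - v i 0 by rewrite !mxE.
apply: cV_norm_le; apply: ord3P; rewrite cB ?E0 ?E0' ?E1 ?E1' ?E2 ?E2'.
- by rewrite subrr normr0 mulr_ge0// ltW.
- by rewrite -opprD normrN; exact: prod.
- exact: prod.
Qed.

Theorem proposition4p3 (R : realType) (beta sigma rho d : R)
    (f : 'cV[R]_3) (U : set R)
    (beta_gt0 : 0 < beta) (sigma_gt0 : 0 < sigma) (rho_gt0 : 0 < rho)
    (d_sqr : d ^+ 2 = 4 * rho * sigma + (sigma - 1) ^+ 2)
    (s_neq0 : lorenz_s beta sigma rho <> 0)
    (f_neq0 : f <> 0)
    (U_bounded : bounded_set U)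
    (U_affine : affine_hull U = setT) :
  (STLC (lorenz_drift beta sigma rho) f U 0 ->
     ~ lorenz_exceptional sigma rho d f) /\
  (interior (convex_hull U) 0 ->
     ~ lorenz_exceptional sigma rho d f ->
     STLC (lorenz_drift beta sigma rho) f U 0).
Proof.
split; first exact: STLC_not_exceptional.
move=> U0 nexc.
have [a [b [Ua Ub a0 b0]]] := hull_neg_pos U0.
have nf : ~ (f 2 0 = 0 \/
    rho * f 0 0 ^+ 2 + (sigma - 1) * (f 0 0 * f 1 0) - sigma * f 1 0 ^+ 2 = 0).
  by move=> /(lorenz_exceptionalE f sigma_gt0 rho_gt0 d_sqr).
have F0 : lorenz_drift beta sigma rho 0 = 0.
  have [E0 E1 E2] := lorenz_driftE beta sigma rho 0.
  apply/matrixP => i j; rewrite ord1.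
  apply: (ord3P (P := fun i => _ i 0 = (0 : 'cV[R]_3) i 0)) i;
    rewrite ?E0 ?E1 ?E2 !mxE; ring.
apply: (bang_bang_STLC F0 _ Ua Ub a0 b0); first exact: lorenz_remainder.
by apply: lorenz_steering; apply/eqP => // E; apply: nf; [left|right].
Qed.
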